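(* Let $\Gamma$ be a free group of finite rank $n\geq 2$ and let $H<\Gamma$ be a subgroup of finite rank. The following are equivalent: (1) $H$ has infinite index in $\Gamma$. (2) The space $\mathrm{H}_{\mathrm b}^2(\Gamma,H;\mathbb{R})$ is non-trivial. (3) The space $\mathrm{H}_{\mathrm b}^2(\Gamma,H;\mathbb{R})$ is infinite dimensional as a real vector space. (4) There exists a linear isometric embedding $\oplus_{\infty}^n\mathcal{D}(\mathbb{Z})\hookrightarrow \mathrm{H}_{\mathrm b}^2(\Gamma,H;\mathbb{R})$.
   Context: For a discrete group $G$ and $m\ge 1$, let $\mathrm{C}_{\mathrm b}^m(G)$ be the space of bounded functions $f:G^m\to\mathbb{R}$, with coboundary $d^m:\mathrm{C}_{\mathrm b}^m(G)\to \mathrm{C}_{\mathrm b}^{m+1}(G)$, $$d^m f(\gamma_1,\dots,\gamma_{m+1})=f(\gamma_2,\dots,\gamma_{m+1})+\sum_{i=1}^m(-1)^i f(\gamma_1,\dots,\gamma_i\gamma_{i+1},\dots,\gamma_{m+1})+(-1)^{m+1}f(\gamma_1,\dots,\gamma_m).$$ For a subgroup $H$ of $\Gamma$, $\mathrm{C}_{\mathrm b}^m(\Gamma,H)$ is the kernel of the restriction map $\mathrm{C}_{\mathrm b}^m(\Gamma)\to \mathrm{C}_{\mathrm b}^m(H)$, i.e. the bounded functions on $\Gamma^m$ vanishing on $H^m$. The relative second bounded cohomology is $$\mathrm{H}_{\mathrm b}^2(\Gamma,H;\mathbb{R})=\ker\big(d^2|_{\mathrm{C}_{\mathrm b}^2(\Gamma,H)}\big)/d^1\big(\mathrm{C}_{\mathrm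 b}^1(\Gamma,H)\big),$$ equipped with the semi-norm $\|\beta\|_\infty=\inf\{\|\xi\|_\infty : \xi\in \mathrm{C}_{\mathrm b}^2(\Gamma,H),\ d^2\xi=0,\ [\xi]=\beta\}$, where $\|\cdot\|_\infty$ on cochains is the supremum norm. $\mathcal{D}(\mathbb{Z})$ is the space of bounded functions $f:\mathbb{Z}\to\mathbb{R}$ that are alternating (i.e. $f(-m)=-f(m)$ for all $m$), equipped with the defect norm $\|f\|=\mathrm{def}\,f=\sup_{a,b\in\mathbb{Z}}|f(a+b)-f(a)-f(b)|$. The space $\oplus_\infty^n\mathcal{D}(\mathbb{Z})$ is the direct sum of $n$ copies of $\mathcal{D}(\mathbb{Z})$ equipped with the max-norm $\|(f_1,\dots,f_n)\|=\max_i\|f_i\|$. *)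

(* Defs.v *)
From HB Require Import structures.
From mathcomp Require Import all_boot all_order all_algebra.
From mathcomp Require Import all_classical reals ring.

Set Implicit Arguments.
Unset Strict Implicit.
Unset Printing Implicit Defensive.

Import Order.TTheory GRing.Theory Num.Theory.

Local Open Scope classical_set_scope.
Local Open Scope ring_scope.

(* [free_basis x] is the universal property of a free group: every map from
   the index set to a group extends uniquely to a homomorphism. *)
Definition free_basis (G : groupType) (I : Type) (x : I -> G) : Prop :=
  forall (K : groupType) (f : I -> K),
    exists! phi : G -> K,
      {morph phi : a b / (a * b)%g >-> (a * b)%g} /\
      (forall i, phi (x i) = f i).

Definition free_of_rank (G : groupType) (n : nat) : Prop :=
  exists x : 'I_n -> G, free_basis x.

(* The rank of a group is the least size of a generating set (for a free group,
   the size of a basis), so finite rank means finitely generated.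
   A subgroup is a boolean predicate; as the logic is classical, every
   subset closed under the group operations arises this way. *)
Definition finite_rank (G : groupType) (H : groupClosed G) : Prop :=
  exists s : seq G, {subset s <= H} /\
    (forall K : groupClosed G, {subset s <= K} -> {subset H <= K}).

Definition left_coset (G : groupType) (H : {pred G}) (g : G) : set G :=
  [set (g * h)%g | h in [set h | h \in H]].

Definition infinite_index (G : groupType) (H : groupClosed G) : Prop :=
  infinite_set (range (left_coset H)).

Section LmodQuotient.
Variables (R : pzRingType) (V : lmodType R) (W : {pred V}).
Variable W_submod : submod_closed W.

(* The bundled [submodClosed] is stated over semirings, hence does not entail
   closure under opposite, which [Quotient.quot] requires: the closure
   instances are declared on this alias of W. *)
Definition submod_pred of submod_closed W : {pred V} := W.

HB.instance Definition _ :=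
  GRing.isSubmodClosed.Build R V (submod_pred W_submod) W_submod.

Local Notation W' := (submod_pred W_submod).

(* [Quotient.quot] only provides the additive structure. *)
Definition lmod_quot : Type := Quotient.quot W'.

HB.instance Definition _ := GRing.Zmodule.on lmod_quot.

Definition to_quot (x : V) : lmod_quot := \pi_(Quotient.quot W')%qT x.
Definition of_quot (b : lmod_quot) : V := repr (b : Quotient.quot W').

Lemma of_quotK b : to_quot (of_quot b) = b.
Proof. exact: reprK. Qed.

Lemma to_quot_eq x y : (to_quot x = to_quot y) <-> (x - y \in W).
Proof.
rewrite (Quotient.idealrBE W' x y); split=> [e|/eqP//].
exact/eqP.
Qed.

Lemma to_quotB : {morph to_quot : x y / x - y}.
Proof. by move=> x y; rewrite /to_quot raddfB. Qed.

Lemma to_quotD : {morph to_quot : x y / x + y}.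
Proof. by move=> x y; rewrite /to_quot raddfD. Qed.

Definition quot_scale (a : R) (b : lmod_quot) : lmod_quot :=
  to_quot (a *: of_quot b).

Lemma to_quotZ a x : to_quot (a *: x) = quot_scale a (to_quot x).
Proof.
apply/to_quot_eq; rewrite -scalerBr; apply: (rpredZ (s := W')).
by apply/to_quot_eq; rewrite of_quotK.
Qed.

Lemma quot_scaleA a b v : quot_scale a (quot_scale b v) = quot_scale (a * b) v.
Proof. by rewrite -[v]of_quotK -!to_quotZ scalerA. Qed.

Lemma quot_scale1 : left_id 1 quot_scale.
Proof. by move=> v; rewrite -[v]of_quotK -to_quotZ scale1r. Qed.

Lemma quot_scaleDr : right_distributive quot_scale +%R.
Proof.
by move=> a u v; rewrite -[u]of_quotK -[v]of_quotK -to_quotD -!to_quotZ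
  -to_quotD scalerDr.
Qed.

Lemma quot_scaleDl v : {morph quot_scale^~ v : a b / a + b}.
Proof.
by move=> a b /=; rewrite -[v]of_quotK -!to_quotZ -to_quotD scalerDl.
Qed.

HB.instance Definition _ := GRing.Zmodule_isLmodule.Build R lmod_quot
  quot_scaleA quot_scale1 quot_scaleDr quot_scaleDl.

Lemma to_quot_is_linear : linear to_quot.
Proof. by move=> a x y; rewrite to_quotD to_quotZ. Qed.

HB.instance Definition _ :=
  GRing.isLinear.Build R V lmod_quot _ to_quot to_quot_is_linear.

End LmodQuotient.

Section Cochains.
Variables (R : realType) (G : groupType).

Definition cochain (m : nat) : Type := ('I_m -> G) -> R^o.

(* Indices are 0-based: [face i] multiplies the entries i and i + 1 of g. *)
Definition face m (i : 'I_m) (g : 'I_m.+1 -> G) : 'I_m -> G := fun j =>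
  if (j < i)%N then g (widen_ord (leqnSn m) j)
  else if j == i then (g (widen_ord (leqnSn m) j) * g (lift ord0 j))%g
  else g (lift ord0 j).

Definition coboundary m (f : cochain m) : cochain m.+1 := fun g =>
  f (fun j => g (lift ord0 j))
  + \sum_(i < m) (-1) ^+ i.+1 * f (face i g)
  + (-1) ^+ m.+1 * f (fun j => g (widen_ord (leqnSn m) j)).

Lemma coboundary_is_linear m : linear (@coboundary m).
Proof.
move=> a f h; apply/funext => g; rewrite /coboundary !fctE.
have -> : \sum_(i < m) (-1) ^+ i.+1 * (a *: f (face i g) + h (face i g)) =
    a * (\sum_(i < m) (-1) ^+ i.+1 * f (face i g)) +
    \sum_(i < m) (-1) ^+ i.+1 * h (face i g).
  by rewrite mulr_sumr -big_split /=; apply: eq_bigr => i _;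
    rewrite mulrDr mulrCA.
by rewrite /GRing.scale /=; ring.
Qed.

HB.instance Definition _ m :=
  GRing.isLinear.Build R (cochain m) (cochain m.+1) _ (@coboundary m)
    (@coboundary_is_linear m).

Lemma coboundary1E (f : cochain 1) (g : 'I_2 -> G) :
  coboundary f g = f (fun=> g ord_max) - f (fun=> (g ord0 * g ord_max)%g)
                   + f (fun=> g ord0).
Proof.
rewrite /coboundary big_ord1 expr1 mulN1r sqrrN expr1n mul1r.
by congr (f _ - f _ + f _); apply/funext => j; rewrite /face (ord1 j) /=;
  do ?[congr (_ * _)%g]; congr g; apply/val_inj.
Qed.

Lemma coboundary2E (f : cochain 2) (g : 'I_3 -> G) :
  let pair a b : 'I_2 -> G := fun j => if j == ord0 then a else b in
  let g1 := g (inord 0) in let g2 := g (inord 1) in let g3 := g (inord 2) in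
  coboundary f g = f (pair g2 g3) - f (pair (g1 * g2)%g g3)
                   + f (pair g1 (g2 * g3)%g) - f (pair g1 g2).
Proof.
move=> pair g1 g2 g3; rewrite /coboundary big_ord_recl big_ord1.
rewrite !exprS !expr0 !(mulN1r, mulr1, mul1r, opprK) addrA.
by congr (f _ - f _ + f _ - f _); apply/funext => -[[|[|//]] jlt];
  rewrite /face /pair /g1 /g2 /g3 /=; do ?[congr (_ * _)%g];
  congr g; apply/val_inj; rewrite /= ?inordK.
Qed.

Definition bounded (T : Type) (f : T -> R) : Prop :=
  exists M : R, forall x, `|f x| <= M.

Lemma bounded0 T : bounded (fun _ : T => 0).
Proof. by exists 0 => x; rewrite normr0. Qed.

Lemma bounded_lin T (a : R) (f g : T -> R) :
  bounded f -> bounded g -> bounded (fun x => a * f x + g x).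
Proof.
move=> [M fM] [N gN]; exists (`|a| * M + N) => x.
by rewrite (le_trans (ler_normD _ _))// lerD// normrM ler_wpM2l.
Qed.

Definition supnorm (T : Type) (f : T -> R) : R := sup (range (fun x => `|f x|)).

Section Relative.
Variable H : groupClosed G.

Definition rel_bcochain m : {pred cochain m} := [pred f : cochain m |
  `[< bounded f /\ forall g, (forall i, g i \in H) -> f g = 0 >]].

Lemma rel_bcochainP m (f : cochain m) :
  reflect (bounded f /\ forall g, (forall i, g i \in H) -> f g = 0)
          (f \in @rel_bcochain m).
Proof. exact: asboolP. Qed.

Lemma rel_bcochain_submod m : submod_closed (@rel_bcochain m).
Proof.
split; first by apply/rel_bcochainP; split; [exact: bounded0|].
move=> a f g /rel_bcochainP[bf f0] /rel_bcochainP[bg g0].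
apply/rel_bcochainP; split=> [|x xH]; first exact: bounded_lin.
by rewrite !fctE f0// g0// scaler0 addr0.
Qed.

HB.instance Definition _ m :=
  GRing.isSubmodClosed.Build R (cochain m) (@rel_bcochain m)
    (@rel_bcochain_submod m).

Definition rel_bcocycle : {pred cochain 2} :=
  [pred f : cochain 2 | (f \in @rel_bcochain 2) && (coboundary f == 0)].

Lemma rel_bcocycle_submod : submod_closed rel_bcocycle.
Proof.
split; first by apply/andP; rewrite rpred0 linear0 eqxx.
move=> a f g /andP[fC /eqP df] /andP[gC /eqP dg].
by apply/andP; rewrite rpredD ?rpredZ//= coboundary_is_linear df dg scaler0 addr0.
Qed.

HB.instance Definition _ :=
  GRing.isSubmodClosed.Build R (cochain 2) rel_bcocycle rel_bcocycle_submod.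

Lemma coboundary_rel_bcocycle (f : cochain 1) :
  f \in @rel_bcochain 1 -> coboundary f \in rel_bcocycle.
Proof.
move=> /rel_bcochainP[[M fM] f0]; apply/andP; split.
  apply/rel_bcochainP; split=> [|g gH]; last first.
    by rewrite coboundary1E !f0 ?subr0 ?addr0// => _; apply: gpredM.
  exists (M + M + M) => g; rewrite coboundary1E.
  by rewrite (le_trans (ler_normD _ _))// lerD// (le_trans (ler_normB _ _))//
    lerD.
apply/eqP/funext => g; rewrite coboundary2E !coboundary1E /= mulgA.
by rewrite [RHS]/GRing.zero /=; ring.
Qed.

Definition rel_Z2 : Type := {f : cochain 2 | f \in rel_bcocycle}.

HB.instance Definition _ := [isSub of rel_Z2 for @sval _ _].
HB.instance Definition _ := [Choice of rel_Z2 by <:].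
HB.instance Definition _ :=
  [SubChoice_isSubLmodule of rel_Z2 by <:].

(* By [coboundary_rel_bcocycle] this is the whole image of the relative bounded
   1-cochains. *)
Definition rel_B2 : {pred rel_Z2} := [pred z : rel_Z2 |
  `[< exists2 f : cochain 1, f \in @rel_bcochain 1 & coboundary f = val z >]].

Lemma rel_B2P (z : rel_Z2) :
  reflect (exists2 f : cochain 1, f \in @rel_bcochain 1 & coboundary f = val z)
          (z \in rel_B2).
Proof. exact: asboolP. Qed.

Lemma rel_B2_submod : submod_closed rel_B2.
Proof.
split; first by apply/rel_B2P; exists 0; rewrite ?rpred0 ?linear0.
move=> a f g /rel_B2P[f1 f1C df] /rel_B2P[g1 g1C dg].
apply/rel_B2P; exists (a *: f1 + g1); first by rewrite rpredD ?rpredZ.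
by rewrite coboundary_is_linear df dg.
Qed.

End Relative.
End Cochains.

Section RelativeH2.
Variables (R : realType) (G : groupType) (H : groupClosed G).

Definition rel_Hb2 : Type := lmod_quot (rel_B2_submod R H).

HB.instance Definition _ := GRing.Lmodule.on rel_Hb2.

Definition rel_class (z : rel_Z2 R H) : rel_Hb2 := to_quot (rel_B2_submod R H) z.

Definition Hb2_seminorm (b : rel_Hb2) : R :=
  inf [set supnorm (val z : cochain R G 2) | z in [set z | rel_class z = b]].

End RelativeH2.

Definition finite_dimensional (R : pzRingType) (V : lmodType R) : Prop :=
  exists (N : nat) (v : 'I_N -> V),
    forall x, exists c : 'I_N -> R, x = \sum_(i < N) c i *: v i.

Section AlternatingBounded.
Variable R : realType.

Definition alt_bounded : {pred int -> R^o} := [pred f : int -> R^o |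
  `[< bounded f /\ forall m : int, f (- m) = - f m >]].

Lemma alt_boundedP (f : int -> R^o) :
  reflect (bounded f /\ forall m : int, f (- m) = - f m) (f \in alt_bounded).
Proof. exact: asboolP. Qed.

Lemma alt_bounded_submod : submod_closed alt_bounded.
Proof.
split.
  apply/alt_boundedP; split=> [|m]; first exact: bounded0.
  by rewrite oppr0.
move=> a f g /alt_boundedP[bf fN] /alt_boundedP[bg gN].
apply/alt_boundedP; split=> [|m]; first exact: bounded_lin.
by rewrite !fctE fN gN scalerN opprD.
Qed.

HB.instance Definition _ :=
  GRing.isSubmodClosed.Build R (int -> R^o) alt_bounded alt_bounded_submod.

Definition DZ : Type := {f : int -> R^o | f \in alt_bounded}.

HB.instance Definition _ := [isSub of DZ for @sval _ _].
HB.instance Definition _ := [Choice of DZ by <:].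
HB.instance Definition _ := [SubChoice_isSubLmodule of DZ by <:].

Definition defect (f : int -> R) : R :=
  sup [set r | exists a b : int, r = `|f (a + b) - f a - f b|].

Definition maxnorm n (F : {ffun 'I_n -> DZ}) : R :=
  \big[Num.max/0]_(i < n) defect (val (F i)).

End AlternatingBounded.

(* Main.v *)
(* Call an element y periodic at a coset gH if some positive power of y fixes
   gH. The core of the Schreier graph of H is finite because H is finitely
   generated, so a Nielsen move x_i := x_j^N x_i with N large and divisible
   enough shrinks the set P_i of cosets where x_i is periodic to a subset of
   the intersection of P_i and P_j: periodic orbits stay in the core, where
   x_j^N can only be read from points of P_j. If all P_i coincide they form a
   finite invariant set, which is empty when H has infinite index; hence some
   basis has no periodic cosets at all, and in this basis the exponents in the
   reduced words of H are bounded by some M.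

   For odd bounded functions f_i, Rolli's map sends a reduced word to the sum of
   f_i(k) over its syllables x_i^k; its defect is at most max def f_i. Replacing
   f_i by f_i(k/M) on multiples of M, and 0 elsewhere, does not change def f_i
   and makes the sum vanish on H. That no representative of the class has a
   smaller norm is seen on a pair of pants, triangulated by two ideal triangles:
   the perturbation by a bounded function averages out.

   Conversely, H^2 of a free group is trivial, so a relative cocycle is the
   coboundary of some phi that is a homomorphism on H; for H of finite index,
   averaging over cosets gives a homomorphism at bounded distance from phi,
   hence equal to phi on H. *)
Require Import Defs.
From HB Require Import structures.
From mathcomp Require Import all_boot all_order all_algebra.
From mathcomp Require Import all_classical reals.
From mathcomp Require Import zify ring lra.

Set Implicit Arguments.
Unset Strict Implicit.
Unset Printing Implicit Defensive.

Import Order.TTheory GRing.Theory Num.Theory.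

Local Open Scope ring_scope.

(** * Groups and free bases *)

Section IntegerPowers.
Variable G : groupType.
Implicit Types (x y : G) (k l : int).

Definition zpow x k : G :=
  match k with Posz m => (x ^+ m)%g | Negz m => (x ^- m.+1)%g end.

Lemma zpow_nat x (m : nat) : zpow x m = (x ^+ m)%g. Proof. by []. Qed.

Lemma zpowSl x k : zpow x (k + 1) = (x * zpow x k)%g.
Proof.
case: k => [m|[|m]]; first by rewrite -PoszD addn1 /= expgS.
  by rewrite /= mulgV.
have -> : Negz m.+1 + 1 = Negz m by rewrite !NegzE; lia.
by rewrite /zpow (expgSr _ m.+1) invgM mulVKg.
Qed.

Lemma zpowD x k l : zpow x (k + l) = (zpow x k * zpow x l)%g.
Proof.
elim/int_ind: k => [|m IHm|m IHm]; first by rewrite add0r mul1g.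
- by rewrite -addn1 PoszD -addrA [1 + l]addrC addrA !zpowSl IHm mulgA.
- rewrite -addn1 PoszD; apply: (@mulgI _ x); rewrite mulgA -!zpowSl.
  have -> : - (m + 1)%R%:Z + l + 1 = - m%:Z + l by lia.
  by have -> : - (m + 1)%R%:Z + 1 = - m%:Z by lia.
Qed.

Lemma zpowN x k : zpow x (- k) = (zpow x k)^-1%g.
Proof. by apply: (@mulgI _ (zpow x k)); rewrite -zpowD subrr mulgV. Qed.

End IntegerPowers.

Section Morphisms.
Variables (G K : groupType) (phi : G -> K).
Hypothesis phiM : {morph phi : a b / (a * b)%g}.

Lemma morph_one : phi 1%g = 1%g.
Proof. by apply: (@mulgI _ (phi 1%g)); rewrite -phiM !mulg1. Qed.

Lemma morph_inv a : phi a^-1%g = (phi a)^-1%g.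
Proof. by apply: (@mulgI _ (phi a)); rewrite -phiM !mulgV morph_one. Qed.

Lemma morph_exp a m : phi (a ^+ m)%g = (phi a ^+ m)%g.
Proof. by elim: m => [|m IHm]; rewrite ?morph_one// !expgS phiM IHm. Qed.

Lemma morph_zpow a k : phi (zpow a k) = zpow (phi a) k.
Proof. by case: k => m /=; rewrite ?morph_inv morph_exp. Qed.

End Morphisms.

(** * Subgroups given by a proposition, as predicates and as group types *)

Section Closure.
Variables (G : groupType) (P : G -> Prop).

Record group_prop : Prop := GroupProp {
  group_prop1 : P 1%g;
  group_propM : forall a b, P a -> P b -> P (a * b)%g;
  group_propV : forall a, P a -> P a^-1%g }.

Definition pred_of_prop of group_prop : {pred G} := [pred g | `[< P g >]].

Variable gP : group_prop.

Lemma pred_of_propM : mulg_closed (pred_of_prop gP).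
Proof. by move=> a b /asboolP Pa /asboolP Pb; apply/asboolP/group_propM. Qed.

Lemma pred_of_prop1 : 1%g \in pred_of_prop gP.
Proof. exact/asboolP/group_prop1. Qed.

Lemma pred_of_propV : invg_closed (pred_of_prop gP).
Proof. by move=> a /asboolP Pa; apply/asboolP/group_propV. Qed.

HB.instance Definition _ := isMulClosed.Build G (pred_of_prop gP) pred_of_propM.
HB.instance Definition _ := isMul1Closed.Build G (pred_of_prop gP) pred_of_prop1.
HB.instance Definition _ := isInvClosed.Build G (pred_of_prop gP) pred_of_propV.

Lemma group_prop_closed : exists S : groupClosed G, forall g, g \in S <-> P g.
Proof.
exists (pred_of_prop gP : groupClosed G) => g.
by split=> [/asboolP|Pg]; [|apply/asboolP].
Qed.

Definition subgroup_of of group_prop : Type := {g : G | `[< P g >]}.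

HB.instance Definition _ :=
  [isSub of subgroup_of gP for @sval G (fun g => `[< P g >])].
HB.instance Definition _ := [Choice of subgroup_of gP by <:].

Lemma subgroup_closed : group_closed (pred_of_prop gP).
Proof.
split; first exact: pred_of_prop1.
by move=> a b aP bP; apply: pred_of_propM => //; apply: pred_of_propV.
Qed.

HB.instance Definition _ := SubChoice_isSubGroup.Build G (fun g => `[< P g >])
  (subgroup_of gP) subgroup_closed.

End Closure.

(** * The group of permutations of a type *)

Section Bijections.
Variable T : Type.

(** The inverse is data, but determined by the map, so equality is pointwise. A homomorphism from a
    free group to this group is an action. *)
Record bijection := Bijection {
  bfun :> T -> T;
  binv : T -> T;
  bfunK : cancel bfun binv;
  binvK : cancel binv bfun }.

Lemma bijection_eq (f g : bijection) : f =1 g -> f = g.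
Proof.
case: f g => [f f' fK f'K] [g g' gK g'K] /= fg.
have {}fg : f = g by apply/funext.
rewrite -{}fg in gK g'K *.
have f'g' : f' = g' by apply/funext => t; rewrite -{1}(g'K t) fK.
rewrite -{}f'g' in gK g'K *.
by congr Bijection; apply: Prop_irrelevance.
Qed.

HB.instance Definition _ := gen_eqMixin bijection.
HB.instance Definition _ := gen_choiceMixin bijection.

Definition bij_one := @Bijection id id (fun=> erefl) (fun=> erefl).

Definition bij_inv (f : bijection) := Bijection (@binvK f) (@bfunK f).

Definition bij_mul (f g : bijection) :=
  Bijection (can_comp (@bfunK f) (@bfunK g)) (can_comp (@binvK g) (@binvK f)).

Lemma bij_mulA : associative bij_mul.
Proof. by move=> f g h; apply: bijection_eq. Qed.

Lemma bij_mul1g : left_id bij_one bij_mul.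
Proof. by move=> f; apply: bijection_eq. Qed.

Lemma bij_mulg1 : right_id bij_one bij_mul.
Proof. by move=> f; apply: bijection_eq. Qed.

Lemma bij_mulVg : left_inverse bij_one bij_inv bij_mul.
Proof. by move=> f; apply: bijection_eq => t /=; rewrite bfunK. Qed.

Lemma bij_mulgV : right_inverse bij_one bij_inv bij_mul.
Proof. by move=> f; apply: bijection_eq => t /=; rewrite binvK. Qed.

HB.instance Definition _ := isGroup.Build bijection
  bij_mulA bij_mul1g bij_mulg1 bij_mulVg bij_mulgV.

Lemma bijM (f g : bijection) t : (f * g)%g t = f (g t). Proof. by []. Qed.

End Bijections.

Section FreeBasis.
Variables (G : groupType) (I : Type) (x : I -> G).
Hypothesis x_free : free_basis x.

Lemma free_ext (K : groupType) (phi psi : G -> K) :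
    {morph phi : a b / (a * b)%g} -> {morph psi : a b / (a * b)%g} ->
  (forall i, phi (x i) = psi (x i)) -> phi = psi.
Proof.
move=> phiM psiM phi_psi; have [chi [_ chi_uniq]] := x_free (psi \o x).
have <- : chi = phi by apply: chi_uniq; split.
by apply: chi_uniq; split.
Qed.

(* The homomorphism from [G] to the subgroup [P] that fixes the basis becomes
   the identity in [G]. *)
Lemma free_ind (P : G -> Prop) :
  group_prop P -> (forall i, P (x i)) -> forall g, P g.
Proof.
move=> gP Px g.
have [phi [[phiM phix] _]] :=
  x_free (fun i => exist _ (x i) (asboolT (Px i)) : subgroup_of gP).
have -> : g = val (phi g).
  have := @free_ext G id (val \o phi); rewrite funeqE; apply=> //.
    by move=> a b /=; rewrite phiM.
  by move=> i /=; rewrite phix.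
exact/asboolP/(valP (phi g)).
Qed.

End FreeBasis.

(** Prescribing values [f] on the new family amounts to prescribing them on [x], with
    [f j ^- N * f i] in place of [f i]. *)
Lemma free_basis_nielsen (G : groupType) n (x : 'I_n -> G) (i j : 'I_n) (N : nat) :
  i != j -> free_basis x ->
  free_basis (fun r => if r == i then (x j ^+ N * x i)%g else x r).
Proof.
move=> ij x_free K f.
have ji : (j == i) = false by rewrite eq_sym (negbTE ij).
have [phi [[phiM phix] phi_uniq]] :=
  x_free K (fun r => if r == i then (f j ^- N * f i)%g else f r).
exists phi; split=> [|psi [psiM psix]].
  split=> // r; case: eqP => [->|ri]; last by rewrite phix; case: eqP ri.
  by rewrite phiM (morph_exp phiM) !phix ji eqxx mulVKg.
apply: phi_uniq; split=> // r; case: eqP => [->|ri]; last first.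
  by rewrite -psix; case: eqP ri.
apply: (@mulgI _ (psi (x j) ^+ N)%g).
rewrite -(morph_exp psiM) -psiM.
have := psix i; rewrite eqxx => ->.
have := psix j; rewrite ji => psij.
by rewrite (morph_exp psiM) psij mulVKg.
Qed.

(** * Reduced words *)

Section Words.
Variable n : nat.
Implicit Types (s t : 'I_n * int) (w l : seq ('I_n * int)) (i : 'I_n).

Definition starts_with i w := if w is s :: _ then s.1 == i else false.

Fixpoint reduced w :=
  if w is s :: w' then [&& s.2 != 0, ~~ starts_with s.1 w' & reduced w']
  else true.

Definition push s w :=
  if s.2 == 0 then w else
  if w is t :: w' then
    if s.1 == t.1 then
      if s.2 + t.2 == 0 then w' else (s.1, s.2 + t.2) :: w'
    else s :: w
  else [:: s].

Definition act l w := foldr push w l.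

Definition winv w := rev [seq (s.1, - s.2) | s <- w].

Lemma push_fresh s w :
  s.2 != 0 -> ~~ starts_with s.1 w -> push s w = s :: w.
Proof.
move=> s0; case: w => [|t w] /= st; rewrite /push (negbTE s0)//.
by rewrite eq_sym (negbTE st).
Qed.

Lemma push_reduced s w : reduced w -> reduced (push s w).
Proof.
rewrite /push; case: eqP => // /eqP s0; case: w => [|t w] /=; first by rewrite s0.
case/and3P=> t0 tw rw; case: eqP => [st|/eqP st].
  by case: eqP => [//|/eqP st0] /=; rewrite st0 st tw rw.
by rewrite /= s0 eq_sym st t0 tw rw.
Qed.

Lemma push0 i w : push (i, 0) w = w.
Proof. by rewrite /push eqxx. Qed.

(** This makes [push (i, 1)] a permutation of the reduced words. Reducedness ensures that a
    cancellation exposes no further syllable of [i]. *)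
Lemma pushD i (j k : int) w :
  reduced w -> push (i, j) (push (i, k) w) = push (i, j + k) w.
Proof.
move=> rw; have [->|j0] := eqVneq j 0; first by rewrite push0 add0r.
have [->|k0] := eqVneq k 0; first by rewrite push0 addr0.
have cancel_case u : ~~ starts_with i u ->
    push (i, j) ((i, k) :: u) = push (i, j + k) u.
  move=> iu; rewrite {1}/push /= (negbTE j0) eqxx.
  case: eqP => [->|/eqP jk]; first by rewrite push0.
  by rewrite push_fresh.
case: w rw => [|t w] /=; first by move=> _; rewrite (@push_fresh (i, k)) ?cancel_case.
case/and3P=> t0 tw rw; have [it|it] := eqVneq i t.1; last first.
  have it' : ~~ starts_with i (t :: w) by rewrite /= eq_sym.
  by rewrite (@push_fresh (i, k)) // cancel_case.
rewrite {2}/push /= (negbTE k0) it eqxx.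
case: eqP => [kt|/eqP kt].
  rewrite (@push_fresh (t.1, j)) // /push /= eqxx -addrA kt addr0 (negbTE j0).
  case: eqP => // jk; have -> : j = t.2 by lia.
  by rewrite -surjective_pairing.
rewrite {1}/push /= (negbTE j0) eqxx addrA /push /= eqxx.
by case: (eqVneq (j + k) 0) => [->|//]; rewrite add0r (negbTE t0) -surjective_pairing.
Qed.

Lemma reduced_cat l s w :
  reduced (l ++ [:: s]) -> reduced (s :: w) -> reduced (l ++ s :: w).
Proof.
elim: l => //= t l IHl /and3P[-> tl rl] rw; rewrite (IHl rl rw) andbT.
by case: l tl {IHl rl}.
Qed.

Lemma winv_cons s w : winv (s :: w) = winv w ++ [:: (s.1, - s.2)].
Proof. by rewrite /winv /= rev_cons cats1. Qed.

Lemma winv_reduced w : reduced w -> reduced (winv w).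
Proof.
elim: w => //= s [|t w] IHw /and3P[s0 st rw].
  by rewrite winv_cons /= oppr_eq0 s0.
rewrite winv_cons winv_cons -catA /=; apply: reduced_cat.
  by rewrite -winv_cons IHw.
case/and3P: rw => t0 _ _; rewrite /= !oppr_eq0 t0 s0 /= andbT.
by rewrite eq_sym.
Qed.

Lemma act_cat_reduced l w : reduced (l ++ w) -> act l w = l ++ w.
Proof.
elim: l => //= s l IHl /and3P[s0 sl rl].
by rewrite IHl // push_fresh.
Qed.

Lemma push_behead s w : exists a, push s w = a ++ behead w.
Proof.
rewrite /push; case: eqP => _.
  by case: w => [|t w]; [exists [::]|exists [:: t]].
case: w => [|t w] /=; first by exists [:: s].
case: eqP => _; last by exists [:: s; t].
by case: eqP => _; [exists [::]|exists [:: (s.1, s.2 + t.2)]].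
Qed.

(* A pushed syllable meets at most one syllable of the word below it. *)
Lemma act_suffix l a w :
  (size l <= size a)%N -> exists b, act l (a ++ w) = b ++ w.
Proof.
elim: l a w => [|s l IHl] a w /=; first by exists a.
case: (lastP a) => // {}a t; rewrite size_rcons ltnS => la.
rewrite -cats1 -catA; have [b ->] := IHl a ([:: t] ++ w) la.
have [c ->] := push_behead s (b ++ [:: t] ++ w).
case: b => [|u b] /=; first by exists c.
by exists (c ++ b ++ [:: t]); rewrite -!catA.
Qed.

End Words.

(** * Normal forms of the elements of a free group *)

Section NormalForm.
Variables (G : groupType) (n : nat) (x : 'I_n -> G).
Implicit Types (s t : 'I_n * int) (w l : seq ('I_n * int)) (g h : G).

Definition ev w : G := foldr (fun s g => (zpow (x s.1) s.2 * g)%g) 1%g w.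

Lemma ev_cat l w : ev (l ++ w) = (ev l * ev w)%g.
Proof. by elim: l => [|s l IHl] /=; rewrite ?mul1g// IHl mulgA. Qed.

Lemma ev_push s w : ev (push s w) = (zpow (x s.1) s.2 * ev w)%g.
Proof.
rewrite /push; case: eqP => [->|_]; first by rewrite mul1g.
case: w => [//|t w]; case: eqP => [st|_//].
by case: eqP => [st0|_] /=; rewrite mulgA st -zpowD -?st ?st0 ?mul1g.
Qed.

Lemma ev_act l w : ev (act l w) = (ev l * ev w)%g.
Proof. by elim: l => [|s l IHl] /=; rewrite ?mul1g// ev_push IHl mulgA. Qed.

Lemma ev_winv w : ev (winv w) = (ev w)^-1%g.
Proof.
elim: w => [|s w IHw]; first by rewrite invg1.
by rewrite winv_cons ev_cat IHw /= mulg1 zpowN invgM.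
Qed.

(** A push alters only the front of a word, so a suffix of the result is either an old suffix of [w]
    or the whole word reached after pushing some tail [l2] of [l]. *)
Lemma act_suffixes l w a b : act l w = a ++ b ->
  (exists a', w = a' ++ b) \/
  (exists l1 l2, l = l1 ++ l2 /\ ev b = (ev l2 * ev w)%g).
Proof.
elim: l a b => [|s l IHl] a b /=; first by left; exists a.
have lift_IH c d : act l w = c ++ d -> (exists a', w = a' ++ d) \/
    (exists l1 l2, s :: l = l1 ++ l2 /\ ev d = (ev l2 * ev w)%g).
  case/IHl=> [|[l1 [l2 [-> evd]]]]; first by left.
  by right; exists (s :: l1), l2.
have whole b' : b' = push s (act l w) -> (exists a', w = a' ++ b') \/
    (exists l1 l2, s :: l = l1 ++ l2 /\ ev b' = (ev l2 * ev w)%g).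
  move=> ->; right; exists [::], (s :: l); split=> //.
  by rewrite ev_push ev_act mulgA.
case: a => [|t a]; first by move=> /= /esym; apply: whole.
rewrite {1}/push; case: eqP => _; first exact: lift_IH.
case E : (act l w) => [|u v]; first by case: a => // -[_ <-]; left; exists w; rewrite cats0.
case: eqP => _; last by case=> _; rewrite -E; apply: lift_IH.
case: eqP => _; first by move=> vE; apply: (lift_IH (u :: t :: a)); rewrite E vE.
by case=> _ vE; apply: (lift_IH (u :: a)); rewrite E vE.
Qed.

Hypothesis x_free : free_basis x.

Definition red_word : Type := {w : seq ('I_n * int) | reduced w}.

Definition push_red s (w : red_word) : red_word :=
  exist _ (push s (val w)) (push_reduced s (valP w)).

Lemma push_redK i (k : int) : cancel (push_red (i, k)) (push_red (i, - k)).
Proof.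
move=> w; apply: val_inj => /=.
by rewrite pushD ?(valP w)// addNr push0.
Qed.

Lemma push_redVK i (k : int) : cancel (push_red (i, - k)) (push_red (i, k)).
Proof. by move=> w; rewrite -{1}[k]opprK push_redK. Qed.

Definition push_bij i := Bijection (@push_redK i 1) (@push_redVK i 1).

(** The van der Waerden trick: the universal property makes [G] act on reduced words. By
    [word_actionP], the default value of [xget] is never taken. *)
Definition word_action : G -> bijection red_word :=
  xget (fun=> 1%g) [set phi : G -> bijection red_word |
    {morph phi : a b / (a * b)%g} /\ forall i, phi (x i) = push_bij i].

Lemma word_actionP : {morph word_action : a b / (a * b)%g} /\
  forall i, word_action (x i) = push_bij i.
Proof.
have [phi [phiP _]] := x_free push_bij.
by rewrite /word_action; case: xgetP => [psi ->|/(_ phi)].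
Qed.

Lemma word_action_zpow i (k : int) (w : red_word) :
  val (word_action (zpow (x i) k) w) = push (i, k) (val w).
Proof.
have [actM actx] := word_actionP; rewrite (morph_zpow actM) actx.
elim/int_ind: k w => [|m IHm|m IHm] w; first by rewrite push0.
  rewrite -addn1 PoszD addrC zpowD bijM /= IHm.
  by rewrite pushD ?(valP w).
rewrite -addn1 PoszD addrC opprD zpowD bijM /=.
by rewrite -pushD ?(valP w)// -IHm.
Qed.

Lemma word_action_ev l (w : red_word) : val (word_action (ev l) w) = act l (val w).
Proof.
have [actM _] := word_actionP.
elim: l => [|s l IHl] /=; first by rewrite (morph_one actM).
by rewrite actM bijM word_action_zpow IHl -surjective_pairing.
Qed.

Definition nf g : seq ('I_n * int) :=
  val (word_action g (exist _ [::] erefl)).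

Lemma nf_reduced g : reduced (nf g).
Proof. exact: valP. Qed.

Lemma nf_ev w : reduced w -> nf (ev w) = w.
Proof.
by move=> rw; rewrite /nf word_action_ev -[RHS]cats0 act_cat_reduced ?cats0.
Qed.

(** Evaluation is equivariant from [word_action] to left multiplication: the elements for which this
    holds form a subgroup containing the basis. *)
Lemma nfK g : ev (nf g) = g.
Proof.
have [actM actx] := word_actionP.
suff ev_action : forall w : red_word, ev (val (word_action g w)) = (g * ev (val w))%g.
  by rewrite ev_action mulg1.
move: g; apply: (free_ind x_free) => [|i w]; last by rewrite actx /= ev_push.
split=> [w|a b Pa Pb w|a Pa w]; first by rewrite (morph_one actM) mul1g.
  by rewrite actM bijM Pa Pb mulgA.
apply: (@mulgI _ a); rewrite mulVKg -Pa -bijM -actM mulgV.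
by rewrite (morph_one actM).
Qed.

Lemma nf1 : nf 1%g = [::].
Proof. exact: (@nf_ev [::]). Qed.

Lemma nf_ev_mul l g : nf (ev l * g)%g = act l (nf g).
Proof.
by rewrite /nf word_actionP.1 bijM word_action_ev.
Qed.

Lemma nfM g h : nf (g * h)%g = act (nf g) (nf h).
Proof. by rewrite -{1}(nfK g) nf_ev_mul. Qed.

Lemma nf_zpow_mul i (k : int) g : nf (zpow (x i) k * g)%g = push (i, k) (nf g).
Proof. by rewrite -[push _ _]/(act [:: (i, k)] (nf g)) -nf_ev_mul /= mulg1. Qed.

End NormalForm.

(** * Bases without periodic cosets *)

Lemma seq_uniform_bound (T : eqType) (Q : T -> nat -> Prop) (s : seq T) :
    (forall c, exists B, forall N, (B <= N)%N -> Q c N) ->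
  exists B, forall N, (B <= N)%N -> forall c, c \in s -> Q c N.
Proof.
move=> QP; elim: s => [|c s [B sB]]; first by exists 0%N.
have [B' cB'] := QP c; exists (maxn B B') => N; rewrite geq_max => /andP[BN B'N] d.
by rewrite inE => /predU1P[->|/sB]; [exact: cB'|exact].
Qed.

Section Cosets.
Variables (G : groupType) (H : groupClosed G).
Implicit Types (a g h c y : G).

(** Equality of left cosets, on which [G] acts by left multiplication: these are the vertices of the
    Schreier graph. *)
Definition coeq g h : Prop := (g^-1 * h)%g \in H.

Lemma coeq_refl g : coeq g g.
Proof. by rewrite /coeq mulVg gpred1. Qed.

Lemma coeq_sym g h : coeq g h -> coeq h g.
Proof. by rewrite /coeq -gpredV invgM invgK. Qed.

Lemma coeq_trans h g c : coeq g h -> coeq h c -> coeq g c.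
Proof.
rewrite /coeq => gh hc; have := gpredM _ _ gh hc.
by rewrite -mulgA mulVKg.
Qed.

Lemma coeq_mul a g h : coeq (a * g)%g (a * h)%g <-> coeq g h.
Proof. by rewrite /coeq invgM -mulgA mulKg. Qed.

Lemma coeqMr g h : h \in H -> coeq (g * h)%g g.
Proof. by move=> hH; rewrite /coeq invgM mulgVK gpredV. Qed.

Definition periodic y g : Prop :=
  exists2 m, (0 < m)%N & coeq (y ^+ m * g)%g g.

Lemma periodic_coeq y g h : coeq g h -> periodic y g -> periodic y h.
Proof.
move=> gh [m m0 mg]; exists m => //.
by apply: (coeq_trans _ gh); apply: coeq_trans mg; apply/coeq_mul/coeq_sym.
Qed.

Lemma coeq_zpow y g m : coeq (zpow y m * g)%g g ->
  forall q : int, coeq (zpow y (q * m) * g)%g g.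
Proof.
move=> mg; elim/int_ind => [|q IHq|q IHq]; first by rewrite mul0r mul1g; exact: coeq_refl.
  rewrite -addn1 PoszD mulrDl mul1r addrC zpowD -mulgA.
  by apply: coeq_trans mg; apply/coeq_mul.
rewrite -addn1 PoszD opprD mulrDl mulN1r zpowD -mulgA.
apply: coeq_trans IHq; apply/coeq_mul/(coeq_mul (zpow y m)).
by rewrite mulgA -zpowD subrr mul1g; apply: coeq_sym.
Qed.

Lemma coeq_exp y g m k : coeq (y ^+ m * g)%g g -> coeq (y ^+ (k * m) * g)%g g.
Proof. by move=> /(@coeq_zpow _ _ m)/(_ k); rewrite -PoszM. Qed.

Lemma periodic_zpow y g k : periodic y (zpow y k * g)%g <-> periodic y g.
Proof.
have shift m : (y ^+ m * (zpow y k * g))%g = (zpow y k * (y ^+ m * g))%g.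
  by rewrite !mulgA -!zpow_nat -!zpowD addrC.
by split=> -[m m0 mg]; exists m => //; move: mg; rewrite shift => /coeq_mul.
Qed.

(** If [y ^+ N0] and [y ^+ N] with [N0 < N] send [c] to the same coset, then [y ^+ (N - N0)] fixes
    the coset of [c]. As [C] is finite, one bound serves all pairs. *)
Lemma periodic_bound y (C : seq G) : exists B, forall N, (B <= N)%N ->
  forall g c c', c \in C -> c' \in C ->
    coeq g c -> coeq (y ^+ N * g)%g c' -> periodic y g.
Proof.
suff [B BP] : exists B, forall N, (B <= N)%N -> forall c, c \in C ->
    forall c', c' \in C -> coeq (y ^+ N * c)%g c' -> periodic y c.
  exists B => N BN g c c' cC c'C gc gc'; apply: (periodic_coeq (coeq_sym gc)).
  apply: (BP N BN c cC c' c'C); apply: coeq_trans gc'.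
  exact/coeq_mul/coeq_sym.
apply: seq_uniform_bound => c.
suff [B BP] : exists B, forall N, (B <= N)%N -> forall c', c' \in C ->
    coeq (y ^+ N * c)%g c' -> periodic y c.
  by exists B.
apply: seq_uniform_bound => c'.
have [[N0 N0P]|noN] := pselect (exists N, coeq (y ^+ N * c)%g c'); last first.
  by exists 0%N => N _ Nc; case: noN; exists N.
exists N0.+1 => N N0N Nc; exists (N - N0)%N; first by rewrite subn_gt0.
apply/(coeq_mul (y ^+ N0)%g); rewrite mulgA -expgnDr subnKC 1?ltnW//.
exact: coeq_trans Nc (coeq_sym N0P).
Qed.

Lemma periodic_exponent y (X : seq G) :
    (forall g, periodic y g -> exists2 c, c \in X & coeq g c) ->
  exists2 Q, (0 < Q)%N & forall g, periodic y g -> coeq (y ^+ Q * g)%g g.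
Proof.
move=> XP.
suff [Q Q0 QP] : exists2 Q, (0 < Q)%N & forall c, c \in X -> periodic y c ->
    coeq (y ^+ Q * c)%g c.
  exists Q => // g gper; have [c cX gc] := XP g gper.
  apply: (coeq_trans _ (coeq_sym gc)).
  apply: (coeq_trans _ (QP c cX (periodic_coeq gc gper))).
  exact/coeq_mul.
elim: X {XP} => [|c X [Q Q0 QP]]; first by exists 1%N.
have [[m m0 mc]|cnper] := pselect (periodic y c); last first.
  by exists Q => // d; rewrite inE => /predU1P[-> //|]; apply: QP.
exists (Q * m)%N => [|d]; first by rewrite muln_gt0 Q0.
rewrite inE => /predU1P[-> _|dX dper]; first exact: coeq_exp.
by rewrite mulnC; apply/coeq_exp/QP.
Qed.

Lemma periodic_orbit y c : exists X : seq G, periodic y c ->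
  forall k, exists2 d, d \in X & coeq (zpow y k * c)%g d.
Proof.
have [[m m0 mc]|cnper] := pselect (periodic y c); last by exists [::].
exists [seq (y ^+ r * c)%g | r <- iota 0 m] => _ k.
exists (zpow y (k %% m)%Z * c)%g.
  have m0Z : m%:Z != 0 by rewrite -lt0n.
  have := modz_ge0 k m0Z; have := ltz_mod k m0Z; case: (k %% m)%Z => // r /= rm _.
  by apply: map_f; rewrite mem_iota add0n; move: rm; lia.
rewrite [in X in coeq X](divz_eq k m) addrC zpowD -mulgA.
by apply/coeq_mul; apply: coeq_zpow; rewrite zpow_nat.
Qed.

Lemma periodic_orbits y (C : seq G) : exists X : seq G,
  forall c, c \in C -> periodic y c ->
  forall k, exists2 d, d \in X & coeq (zpow y k * c)%g d.
Proof.
elim: C => [|c C [X XP]]; first by exists [::].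
have [Y YP] := periodic_orbit y c; exists (Y ++ X) => d.
rewrite inE => /predU1P[->|dC] dper k.
  by have [e eY ?] := YP dper k; exists e; rewrite ?mem_cat ?eY.
by have [e eX ?] := XP d dC dper k; exists e; rewrite ?mem_cat ?eX ?orbT.
Qed.

End Cosets.

(** * The core, and the periodic cosets of basis elements *)

Section Core.
Variables (G : groupType) (H : groupClosed G).
Hypothesis H_fin : finite_rank H.
Variables (n : nat) (x : 'I_n -> G).
Hypothesis x_free : free_basis x.
Implicit Types (g h c : G).

Local Notation nf := (nf x).

(* The vertices of the core of the Schreier graph of [H], with respect to the
   basis [x], are cosets met while reading a reduced word of [H]: finitely many. *)
Lemma finite_core : exists C : seq G, forall h, h \in H ->
  forall a b, nf h = a ++ b -> exists2 c, c \in C & coeq H (ev x b) c.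
Proof.
have [s [sH s_gen]] := H_fin.
pose suf h := [seq ev x (drop k (nf h)) | k <- iota 0 (size (nf h)).+1].
pose C := 1%g :: flatten [seq suf h ++ suf h^-1%g | h <- s].
pose Q h := forall a b, nf h = a ++ b -> exists2 c, c \in C & coeq H (ev x b) c.
(* A suffix of the product is a suffix for [h], or a suffix for [g] times [h]; as [h] lies in [H],
   the latter is in the coset of the suffix for [g]. *)
have QM g h : h \in H -> Q g -> Q h -> Q (g * h)%g.
  move=> hH Qg Qh a b; rewrite (nfM x_free) => /(@act_suffixes _ _ x)[[a' /Qh//]|].
  move=> [l1 [l2 [/Qg[c cC l2c] ->]]]; exists c => //; rewrite (nfK x_free).
  by apply: coeq_trans l2c; apply: coeqMr.
have Qsuf g a b : nf g = a ++ b -> ev x b \in suf g.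
  move=> gE; apply/mapP; exists (size a); last by rewrite gE drop_size_cat.
  by rewrite mem_iota add0n leq0n gE size_cat ltnS leq_addr.
have Q1 : Q 1%g.
  move=> a b; rewrite (nf1 x_free) => /esym/nilP; rewrite /nilp size_cat addn_eq0.
  case/andP=> _ /nilP ->; exists 1%g; first by rewrite inE eqxx.
  exact: coeq_refl.
(* Carrying [Q] for both an element and its inverse makes closure under inversion immediate. *)
have gP : group_prop (fun h => [/\ h \in H, Q h & Q h^-1%g]).
  split; first by rewrite invg1; split=> //; apply: gpred1.
    move=> g h [gH Qg QgV] [hH Qh QhV]; split; first exact: gpredM.
      exact: QM.
    by rewrite invgM; apply: QM => //; rewrite gpredV.
  by move=> h [hH Qh QhV]; rewrite invgK gpredV; split.
have [K KP] := group_prop_closed gP.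
exists C => h hH; have /KP[] // : h \in K.
apply: s_gen hH => g gs; apply/KP; split; first exact: sH.
  move=> a b /Qsuf bg; exists (ev x b); last exact: coeq_refl.
  rewrite inE; apply/orP; right; apply/flatten_mapP; exists g => //.
  by rewrite mem_cat bg.
move=> a b /Qsuf bg; exists (ev x b); last exact: coeq_refl.
rewrite inE; apply/orP; right; apply/flatten_mapP; exists g => //.
by rewrite mem_cat bg orbT.
Qed.

Lemma coeq_conj g h : coeq H (h * g)%g g -> (g^-1 * (h * g))%g \in H.
Proof. exact: coeq_sym. Qed.

(** Without its leading power of [x i], the word of [g] is a [w] such that conjugating [x i ^+ m] by
    [w] gives a reduced word of [H]. So [w] is in the core, and periodic core cosets have finite
    orbits. *)
Lemma periodic_finite i : exists X : seq G,
  forall g, periodic H (x i) g -> exists2 c, c \in X & coeq H g c.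
Proof.
have [C CP] := finite_core; have [X XP] := periodic_orbits H (x i) C.
exists X => g gper.
have [k [w [gE iw rw]]] : exists (k : int) w,
    [/\ g = (zpow (x i) k * ev x w)%g, ~~ starts_with i w & reduced w].
  have := nfK x_free g; have := nf_reduced x g.
  case: (nf g) => [|s w] rw gE; first by exists 0, [::]; rewrite mul1g.
  have [si|si] := eqVneq s.1 i; last by exists 0, (s :: w); rewrite mul1g.
  case/and3P: rw => s0 sw rw; exists s.2, w.
  by rewrite -gE /= si -si; split.
have wper : periodic H (x i) (ev x w) by apply/(@periodic_zpow _ H (x i) _ k); rewrite -gE.
have [m m0 mw] := wper.
have rmw : reduced (winv w ++ (i, m%:Z) :: w).
  case: (w) iw rw => [|t v] it rtv; first by rewrite /= andbT -lt0n.
  rewrite winv_cons -catA; apply: reduced_cat.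
    by rewrite -winv_cons; apply: winv_reduced.
  by move: rtv; rewrite /= oppr_eq0 => /and3P[-> tv rv]; rewrite -lt0n m0 eq_sym it tv rv.
have [|c cC wc] := CP _ (coeq_conj mw) (winv w ++ [:: (i, m%:Z)]) w.
  by rewrite -catA /= -(nf_ev x_free rmw) ev_cat /= ev_winv.
have [d dX cd] := XP c cC (periodic_coeq wc wper) k.
exists d => //; rewrite gE; apply: coeq_trans cd; exact/coeq_mul.
Qed.

Section Nielsen.
Variables (i j : 'I_n) (N : nat).
Hypotheses (ij : i != j) (N_gt0 : (0 < N)%N).

Let u := (x j ^+ N * x i)%g.

Lemma nf_nielsen g : nf (u * g)%g = push (j, N%:Z) (push (i, 1) (nf g)).
Proof. by rewrite -!(nf_zpow_mul x_free) mulgA. Qed.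

Lemma nf_nielsen_fresh g : ~~ starts_with i (nf g) ->
  nf (u * g)%g = (j, N%:Z) :: (i, 1) :: nf g.
Proof.
by move=> ig; rewrite nf_nielsen (@push_fresh _ (i, 1)) // push_fresh //= -lt0n.
Qed.

Lemma nielsen_fresh_exp g t :
  ~~ starts_with i (nf g) -> ~~ starts_with i (nf (u ^+ t * g)%g).
Proof.
move=> ig; elim: t => [|t IHt]; first by rewrite mul1g.
by rewrite expgS -mulgA nf_nielsen_fresh //= eq_sym.
Qed.

Lemma nf_nielsen_exp g t : ~~ starts_with i (nf g) -> exists a,
  size a = (2 * t)%N /\ nf (u ^+ t * g)%g = a ++ nf g.
Proof.
move=> ig.
elim: t => [|t [a [sa aE]]]; first by exists [::]; rewrite mul1g.
exists [:: (j, N%:Z), (i, 1) & a]; rewrite /= sa expgS -mulgA.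
by rewrite nf_nielsen_fresh ?nielsen_fresh_exp// aE; split=> //; lia.
Qed.

(** If the words of [g] and [u * g] both begin with [i], the first push did not lengthen the word
    and the second cancelled a syllable; induction on the length applies. *)
Lemma nielsen_fresh g : exists t, ~~ starts_with i (nf (u ^+ t * g)%g).
Proof.
have [k] := ubnP (size (nf g)); elim: k g => // k IHk g.
rewrite ltnS => gk; have [ig|ig] := boolP (starts_with i (nf g)); last first.
  by exists 0%N; rewrite mul1g.
have [ug|ug] := boolP (starts_with i (nf (u * g)%g)); last first.
  by exists 1%N.
suff /IHk[t tP] : (size (nf (u * g)%g) < k)%N.
  by exists t.+1; rewrite expgSr -mulgA.
apply: leq_trans gk; move: ug; rewrite nf_nielsen.
have : (size (push (i, 1%:Z) (nf g)) <= size (nf g))%N.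
  case: (nf g) ig => //= t w /eqP ti.
  by rewrite /push /= ti eqxx; case: eqP => //= _; apply: ltnW.
have N0 : (N%:Z == 0) = false by apply/negbTE; rewrite -lt0n.
have ji : (j == i) = false by rewrite eq_sym (negbTE ij).
case: (push _ _) => [|s w] sw; rewrite /push -[(j, N%:Z).2]/(N%:Z) N0 /= ?ji//.
case: eqP => _ /=; rewrite ?ji//.
by case: eqP => _ /=; rewrite ?ji.
Qed.

End Nielsen.

Lemma periodic_nielsen (i j : 'I_n) : i != j -> exists N, forall g,
  periodic H (x j ^+ N * x i)%g g -> periodic H (x i) g /\ periodic H (x j) g.
Proof.
move=> ij; have [C CP] := finite_core.
have [X XP] := periodic_finite j; have [Q Q0 QP] := periodic_exponent XP.
have [B BP] := periodic_bound H (x j) C.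
(* Divisibility by [Q] makes [x j ^+ N] fix every coset periodic for [x j]; [B <= N] makes a jump by
   [x j ^+ N] within the core imply periodicity. *)
pose N := (Q * B.+1)%N.
have BN : (B <= N)%N by rewrite (leq_trans (leqnSn B))// leq_pmull.
have N0 : (0 < N)%N by rewrite muln_gt0 Q0.
exists N; set u := (x j ^+ N * x i)%g => g gper.
(* Along the axis of [u] the power [x j ^+ N] is read inside the finite core. *)
have fresh_per h : ~~ starts_with i (nf h) -> periodic H u h ->
    periodic H (x j) (x i * h)%g.
  (* The exponent [M] is a multiple of the period exceeding the length [L] of [h^-1], so in
     [h^-1 * u ^+ M * h] the cancellation from the left spares the last [u]. *)
  move=> ih [m m0 mh]; pose L := size (nf h^-1%g).
  have := coeq_conj (coeq_exp L.+1 mh); set M := (L.+1 * m)%N => hH.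
  have LM : (L <= M.-1)%N by rewrite /M; case: m m0 {mh M hH} => // m _; lia.
  have [a [sa aE]] : exists a, size a = (2 * M.-1)%N /\
      nf (u ^+ M * h)%g = a ++ [:: (j, N%:Z), (i, 1) & nf h].
    have M0 : (0 < M)%N by rewrite muln_gt0 m0.
    have [|a aP] := @nf_nielsen_exp _ _ _ ij N0 (u * h)%g M.-1.
      by rewrite nf_nielsen_fresh //= eq_sym.
    have uM : (u ^+ M = u ^+ M.-1 * u)%g by rewrite -expgSr prednK.
    by exists a; rewrite -(nf_nielsen_fresh ij N0 ih) uM -mulgA.
  have [|b bE] := @act_suffix _ (nf h^-1%g) a [:: (j, N%:Z), (i, 1) & nf h].
    by rewrite sa; apply: leq_trans LM _; rewrite leq_pmull.
  have hE : nf (h^-1 * (u ^+ M * h))%g = b ++ [:: (j, N%:Z), (i, 1) & nf h].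
    by rewrite (nfM x_free) aE.
  have [|c cC] := CP _ hH (b ++ [:: (j, N%:Z)]) ((i, 1) :: nf h).
    by rewrite hE -catA.
  have [c' c'C] := CP _ hH b _ hE.
  by rewrite /= !(nfK x_free) => hc' hc; apply: BP hc hc'.
(* Some [u ^+ t0] leads to a word not beginning with [i]; the larger exponent [t0 * m] does so too
   and returns to the same coset. *)
have orbit_per t : periodic H (x j) (x i * (u ^+ t * g))%g.
  have [m m0 mg] := gper; have [t0 t0P] := nielsen_fresh ij N0 (u ^+ t * g)%g.
  set g1 := (u ^+ t * g)%g in t0P *.
  have mg1 : coeq H (u ^+ m * g1)%g g1.
    by rewrite mulgA -expgnDr addnC expgnDr -mulgA; apply/coeq_mul.
  have g1t0 := coeq_exp t0 mg1.
  have : periodic H (x j) (x i * (u ^+ (t0 * m) * g1))%g.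
    apply: fresh_per.
      rewrite -(subnK (leq_pmulr t0 m0)) expgnDr -mulgA.
      exact: nielsen_fresh_exp.
    apply: periodic_coeq (coeq_sym g1t0) _; exists m => //.
  by apply: periodic_coeq; apply/coeq_mul.
(* Since [x j ^+ N] fixes the coset on the right, [u] acts as [x i] along its orbit. *)
have step t : coeq H (u ^+ t.+1 * g)%g (x i * (u ^+ t * g))%g.
  rewrite expgS -!mulgA /N mulnC; apply: coeq_exp.
  exact: QP (orbit_per t).
have same t : coeq H (u ^+ t * g)%g (x i ^+ t * g)%g.
  elim: t => [|t IHt]; first exact: coeq_refl.
  by apply: coeq_trans (step t) _; rewrite expgS -mulgA; apply/coeq_mul.
have [m m0 mg] := gper; split.
  by exists m => //; apply: coeq_trans mg; apply/coeq_sym/same.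
apply: periodic_coeq mg _; rewrite -(prednK m0).
exact: periodic_coeq (coeq_sym (step _)) (orbit_per _).
Qed.

(** A syllable of [H] with a long exponent would join two core cosets by a long power of [x i],
    forcing periodicity. *)
Lemma exponent_bound : (forall i g, ~ periodic H (x i) g) ->
  exists M, forall h, h \in H -> forall s, s \in nf h -> (`|s.2| < M)%N.
Proof.
move=> aper; have [C CP] := finite_core.
have [B BP] : exists B, forall N, (B <= N)%N -> forall i, i \in enum 'I_n ->
    forall g c c', c \in C -> c' \in C ->
    coeq H g c -> ~ coeq H (x i ^+ N * g)%g c'.
  apply: seq_uniform_bound => i; have [B BP] := periodic_bound H (x i) C.
  by exists B => N BN g c c' cC c'C gc gc'; apply: aper (BP N BN g c c' cC c'C gc gc').
exists B => h hH [i k] /= ih; rewrite ltnNge; apply/negP => kB.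
have [a [b nfh]] : exists a b, nf h = a ++ (i, k) :: b.
  by case/splitPr: ih => a b; exists a, b.
have [|c cC bc] := CP _ hH (a ++ [:: (i, k)]) b; first by rewrite nfh -catA.
have [c' c'C /= bc'] := CP _ hH a _ nfh.
move: kB bc'; case: k ih nfh => m ih nfh kB bc'.
  by apply: (BP _ kB i (mem_enum _ _) _ _ _ cC c'C bc bc').
(* A negative exponent is read backwards, from [c'] to [c]. *)
apply: (BP _ kB i (mem_enum _ _) _ _ _ c'C cC bc').
by rewrite /= mulVKg.
Qed.

End Core.

(** * Descent by Nielsen moves *)

Section Aperiodic.
Variables (G : groupType) (H : groupClosed G) (n : nat).
Hypothesis H_fin : finite_rank H.
Hypothesis H_inf : forall X : seq G, exists g, forall c, c \in X -> ~ coeq H g c.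

(** Each [x i] preserves its own periodic cosets; once these sets agree, the common set is invariant
    under [G], which is transitive on cosets. *)
Lemma periodic_all (x : 'I_n -> G) i0 g0 : free_basis x ->
    (forall i j g, periodic H (x i) g -> periodic H (x j) g) ->
  periodic H (x i0) g0 -> forall g, periodic H (x i0) g.
Proof.
move=> x_free all_same g0per g.
pose R a := forall g, periodic H (x i0) (a * g)%g <-> periodic H (x i0) g.
suff Rall : forall a, R a by apply/(Rall (g0 * g^-1)%g); rewrite mulgVK.
apply: (free_ind x_free).
  split=> [h|a b Ra Rb h|a Ra h]; first by rewrite mul1g.
    by rewrite -mulgA Ra Rb.
  by rewrite -Ra mulVKg.
move=> i h; split=> /(all_same _ i); last first.
  by move=> hper; apply/(all_same i)/(@periodic_zpow _ H (x i) h 1).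
by move/(@periodic_zpow _ H (x i) h 1)/(all_same i).
Qed.

Lemma aperiodic_basis (x : 'I_n -> G) : free_basis x ->
  exists y : 'I_n -> G, free_basis y /\ forall i g, ~ periodic H (y i) g.
Proof.
move=> x_free.
have [X XP] : exists X : seq G, forall i g, periodic H (x i) g ->
    exists2 c, c \in X & coeq H g c.
  suff [X XP] : exists X : seq G, forall i, i \in enum 'I_n -> forall g,
      periodic H (x i) g -> exists2 c, c \in X & coeq H g c.
    by exists X => i; apply: XP; apply: mem_enum.
  elim: (enum 'I_n) => [|i s [X XP]]; first by exists [::].
  have [Y YP] := periodic_finite H_fin x_free i.
  exists (Y ++ X) => j; rewrite inE => /predU1P[-> g /YP|js g /(XP j js)] [c cX gc];
  by exists c; rewrite // mem_cat cX ?orbT.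
(* The descent is on the number of pairs of an index and an entry of [X] periodic for it; [X] can
   stay fixed, as the moves used create no periodic coset. *)
pose mu (y : 'I_n -> G) := (\sum_i count (fun c => `[< periodic H (y i) c >]) X)%N.
have [k] := ubnP (mu x); elim: k x x_free XP => // k IHk x x_free XP; rewrite ltnS => muk.
have [[i0 [g0 g0per]]|aper] := pselect (exists i g, periodic H (x i) g); last first.
  by exists x; split=> // i g gper; apply: aper; exists i, g.
have [[i [j [g [gi gj]]]]|same] :=
    pselect (exists i j g, periodic H (x i) g /\ ~ periodic H (x j) g); last first.
  have [g gX] := H_inf X; have gper : periodic H (x i0) g.
    apply: (periodic_all x_free _ g0per) => i j h hi.
    by apply: contrapT => hj; apply: same; exists i, j, h.
  by have [c /gX gc /gc] := XP _ _ gper.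
have ij : i != j by apply/eqP => ij; rewrite ij in gi.
have [N NP] := periodic_nielsen H_fin x_free ij.
pose y r := if r == i then (x j ^+ N * x i)%g else x r.
have yx r h : periodic H (y r) h -> periodic H (x r) h.
  by rewrite /y; case: eqP => [->|//]; case/NP.
apply: (IHk y); first exact: free_basis_nielsen.
  by move=> r h /yx; apply: XP.
apply: leq_trans muk; rewrite /mu (bigD1 i) // [ltnRHS](bigD1 i) //=.
rewrite -addSn leq_add //; last first.
  apply: leq_sum => r _; apply: sub_count => c /asboolP /yx cper; exact/asboolP.
have [c cX gc] := XP _ _ gi.
have cxi : periodic H (x i) c by apply: periodic_coeq gi.
(* At index [i] the coset of [c] is lost, not being periodic for [x j]; hence the strict
   decrease. *)
have cyi : ~ periodic H (y i) c.
  rewrite /y eqxx => /NP[_ cj]; apply: gj.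
  exact: periodic_coeq (coeq_sym gc) cj.
elim: X cX {XP mu IHk} => //= d X IHX; rewrite inE => /predU1P[<-|cX].
  rewrite (asboolT cxi) (asboolF cyi) /= add0n add1n ltnS.
  by apply: sub_count => e /asboolP /yx eper; apply/asboolP.
rewrite -addnS leq_add ?IHX//.
by case: asboolP => // /yx /asboolP ->.
Qed.

End Aperiodic.

(** * Split quasi-morphisms *)

Section SplitQuasimorphism.
Variables (R : realType) (n : nat) (f : 'I_n -> int -> R).
Hypothesis f_odd : forall i k, f i (- k) = - f i k.

Definition word_sum (w : seq ('I_n * int)) : R := \sum_(s <- w) f s.1 s.2.

Lemma word_sum_cons s w : word_sum (s :: w) = f s.1 s.2 + word_sum w.
Proof. exact: big_cons. Qed.

Section Upper.
Variable D : R.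
Hypothesis f_defect : forall i a b, `|f i (a + b) - f i a - f i b| <= D.

(* As long as syllables cancel the sum is additive; the first partial
   cancellation costs at most [D] and is the last one. *)
Lemma word_sum_act l w : reduced l ->
  word_sum (act l w) = word_sum l + word_sum w \/
  `|word_sum (act l w) - word_sum l - word_sum w| <= D /\
    forall i, starts_with i l -> starts_with i (act l w).
Proof.
elim: l => [|s l IHl] rl; first by left; rewrite /word_sum big_nil add0r.
have /and3P[s0 sl rl'] := rl.
have additive : word_sum (act l w) = word_sum l + word_sum w ->
    word_sum (act (s :: l) w) = word_sum (s :: l) + word_sum w \/
    `|word_sum (act (s :: l) w) - word_sum (s :: l) - word_sum w| <= D /\
    forall i, starts_with i (s :: l) -> starts_with i (act (s :: l) w).
  rewrite [act (s :: l) w]/(push s (act l w)) /push (negbTE s0).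
  case: (act l w) => [|t v] E.
    by left; rewrite word_sum_cons E [word_sum (s :: l)]word_sum_cons addrA.
  case: (eqVneq s.1 t.1) => [st|_]; last first.
    by left; rewrite word_sum_cons E [word_sum (s :: l)]word_sum_cons addrA.
  case: (eqVneq (s.2 + t.2) 0) => [st0|_].
    left; rewrite word_sum_cons -addrA -E word_sum_cons st.
    have -> : s.2 = - t.2 by lia.
    by rewrite f_odd addKr.
  right; split=> //; move: E; rewrite !word_sum_cons /= -st => E.
  have := f_defect s.1 s.2 t.2; congr (`|_| <= _).
  have -> : word_sum w = f s.1 t.2 + word_sum v - word_sum l.
    by rewrite E addrAC subrr add0r.
  by ring.
case: l IHl sl rl' rl additive => [|t l] IHl sl rl' rl additive.
  by apply: additive; rewrite /word_sum big_nil add0r.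
case: (IHl rl') => [|[E startsE]]; first exact: additive.
right; have st : starts_with t.1 (act (t :: l) w) by apply: startsE; rewrite /= eqxx.
have fresh : ~~ starts_with s.1 (act (t :: l) w).
  case: (act (t :: l) w) st => [//|u v] /= /eqP ->; by move: sl => /=.
have -> : act [:: s, t & l] w = s :: act (t :: l) w by rewrite -(push_fresh s0 fresh).
split=> //; rewrite word_sum_cons [word_sum (s :: _)]word_sum_cons.
by move: E; congr (`|_| <= _); ring.
Qed.

End Upper.

Variables (G : groupType) (x : 'I_n -> G).
Hypothesis x_free : free_basis x.

Definition split_qm (g : G) : R := word_sum (nf x g).

Lemma split_qm1 : split_qm 1%g = 0.
Proof. by rewrite /split_qm (nf1 x_free) /word_sum big_nil. Qed.

Lemma split_qm_defect D : 0 <= D ->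
    (forall i a b, `|f i (a + b) - f i a - f i b| <= D) ->
  forall g h, `|split_qm h - split_qm (g * h)%g + split_qm g| <= D.
Proof.
move=> D0 f_defect g h; rewrite /split_qm (nfM x_free).
have [->|[E _]] := word_sum_act f_defect (nf x h) (nf_reduced x g).
  by rewrite opprD addrCA subrr addr0 addNr normr0.
by move: E; rewrite -normrN; congr (`|_| <= _); ring.
Qed.

(** * Values of split quasi-morphisms on a pair of pants *)

Section Lower.
Variables (i j : 'I_n).
Hypothesis ij : i != j.

Let X k := zpow (x i) k.
Let Y := x j.

Definition pant k : G := (X k * (Y * (X k * Y^-1)))%g.

Lemma nf_pant k g : k != 0 -> ~~ starts_with j (nf x g) ->
  nf x (pant k * g)%g = [:: (i, k), (j, 1), (i, k), (j, -1) & nf x g].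
Proof.
move=> k0 jg; have ji : (j == i) = false by rewrite eq_sym (negbTE ij).
rewrite /pant -!mulgA (nf_zpow_mul x_free).
rewrite -[Y]/(zpow (x j) 1) (nf_zpow_mul x_free) (nf_zpow_mul x_free).
rewrite -zpowN (nf_zpow_mul x_free).
by do 4![rewrite push_fresh //=; rewrite ?ij ?ji ?(negbTE ij)//].
Qed.

(** The contributions of [x j] and its inverse cancel by oddness. *)
Lemma split_qm_pant k g : k != 0 -> ~~ starts_with j (nf x g) ->
  split_qm (pant k * g)%g = f i k *+ 2 + split_qm g.
Proof.
move=> k0 jg; rewrite /split_qm nf_pant // !word_sum_cons /= f_odd.
by rewrite mulr2n; ring.
Qed.

Lemma pant_exp_start k t g : k != 0 -> ~~ starts_with j (nf x g) ->
  ~~ starts_with j (nf x (pant k ^+ t * g)%g).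
Proof.
move=> k0 jg; elim: t => [|t IHt]; first by rewrite mul1g.
by rewrite expgS -mulgA nf_pant.
Qed.

Lemma split_qm_pant_exp k t g : k != 0 -> ~~ starts_with j (nf x g) ->
  split_qm (pant k ^+ t * g)%g = f i k *+ 2 *+ t + split_qm g.
Proof.
move=> k0 jg; elim: t => [|t IHt]; first by rewrite mul1g add0r.
rewrite expgS -mulgA split_qm_pant ?pant_exp_start// IHt addrA.
by rewrite -mulrS.
Qed.

Variables (k1 k2 k3 : int).
Hypotheses (k123 : k1 + k2 + k3 = 0) (k1n0 : k1 != 0) (k2n0 : k2 != 0) (k3n0 : k3 != 0).

(* [P], [Q] and [S = QP] are, up to inversion, the boundary curves of a pair of
   pants whose spine is a theta graph; the three turns of exponents [k1], [k2],
   [k3] occur at both of its vertices. *)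
Let P := pant (- k1).
Let S := pant k3.
Let Q := (pant (- k2) ^ X k1)%g.

Lemma pants_relation : (Q * P)%g = S.
Proof.
have mulz a b g : (zpow (x i) a * (zpow (x i) b * g) = zpow (x i) (a + b) * g)%g.
  by rewrite mulgA zpowD.
rewrite /Q /P /S /conjg /pant /X -zpowN -!mulgA mulz [X in (Y^-1 * X)%g]mulz.
rewrite subrr mul1g mulKg mulz.
have -> : - k1 + - k2 = k3 by lia.
by have -> : - k2 + - k1 = k3 by lia.
Qed.

Lemma split_qm_PS s t : split_qm (P ^+ s * S ^+ t)%g =
  f i (- k1) *+ 2 *+ s + f i k3 *+ 2 *+ t.
Proof.
have S1 : ~~ starts_with j (nf x 1%g) by rewrite (nf1 x_free).
have := @pant_exp_start k3 t 1%g k3n0 S1; rewrite mulg1 => St.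
rewrite split_qm_pant_exp ?oppr_eq0// -/S; congr (_ + _).
by rewrite -[(S ^+ t)%g]mulg1 split_qm_pant_exp // split_qm1 addr0.
Qed.

(** Conjugation by [X k1] merges syllables only at the two ends of the power of [pant (- k2)], at a
    cost independent of [s] that cancels in the difference. *)
Lemma split_qm_QS s t : split_qm (Q ^+ s.+2 * S ^+ t.+1)%g -
  split_qm (Q ^+ s.+1 * S ^+ t.+1)%g = f i (- k2) *+ 2.
Proof.
pose g0 := (X k1 * S ^+ t.+1)%g.
have g0P : ~~ starts_with j (nf x g0).
  rewrite /g0 expgS (nf_zpow_mul x_free) {1}/S.
  rewrite (@nf_pant k3 (S ^+ t)%g) //; last first.
    by have := @pant_exp_start k3 t 1%g k3n0; rewrite mulg1 (nf1 x_free) => ->.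
  rewrite /push /= (negbTE k1n0) eqxx; case: eqP => [k13|_] /=; last exact: ij.
  by move: k2n0; rewrite -(addKr (k1 + k3) k2) addrAC k123 k13 oppr0 eqxx.
have split r : split_qm (Q ^+ r.+1 * S ^+ t.+1)%g =
    split_qm (pant (- k2) ^+ r.+1 * g0)%g + f i k3 - f i (- k2).
  have -> : (Q ^+ r.+1 * S ^+ t.+1 =
      zpow (x i) (- k1) * (pant (- k2) ^+ r.+1 * g0))%g.
    by rewrite /Q -conjXg conjgE -zpowN /g0 !mulgA.
  have -> : (pant (- k2) ^+ r.+1 * g0 = pant (- k2) * (pant (- k2) ^+ r * g0))%g.
    by rewrite expgS -(mulgA (pant _)).
  rewrite /split_qm (nf_zpow_mul x_free).
  rewrite nf_pant ?oppr_eq0 ?pant_exp_start ?oppr_eq0//.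
  rewrite /push /= oppr_eq0 (negbTE k1n0) eqxx.
  have -> : - k1 - k2 = k3 by lia.
  by rewrite (negbTE k3n0) !word_sum_cons /=; ring.
rewrite !split !split_qm_pant_exp ?oppr_eq0// mulrS.
by ring.
Qed.

End Lower.
End SplitQuasimorphism.

(** * Bounded perturbations and dilations *)

Lemma sumr_const_nat0 (R : nmodType) (c : R) N :
  \sum_(0 <= s < N) c = c *+ N.
Proof. by rewrite sumr_const_nat subn0. Qed.

Section BoundedPerturbation.
Variables (R : realType) (G : groupType) (phi beta : G -> R) (D B : R).
Hypothesis beta_bounded : forall g, `|beta g| <= B.
Hypothesis psi_defect : forall g h, `|(phi h + beta h)
  - (phi (g * h)%g + beta (g * h)%g) + (phi g + beta g)| <= D.
Variables (P Q S : G) (a b c : R).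
Hypothesis QP : (Q * P)%g = S.
Hypothesis phi_PS : forall s t, phi (P ^+ s * S ^+ t)%g = a *+ s + b *+ t.
Hypothesis phi_QS : forall s t,
  phi (Q ^+ s.+2 * S ^+ t.+1)%g - phi (Q ^+ s.+1 * S ^+ t.+1)%g = c.

(* Two adjacent triangles; they share the side [P ^+ s * Q ^- r.+1]. *)
Lemma two_triangles r s t :
  `|(c + a - b) + (beta (Q ^+ r.+2 * S ^+ t.+1)%g - beta (Q ^+ r.+1 * S ^+ t.+1)%g)
    + (beta (P ^+ s.+1 * S ^+ t)%g - beta (P ^+ s * S ^+ t.+1)%g)| <= D *+ 2.
Proof.
have T1 := psi_defect (P ^+ s * Q ^- r.+2)%g (Q ^+ r.+2 * S ^+ t.+1)%g.
have T2 := psi_defect (P ^+ s * Q ^- r.+2)%g (Q ^+ r.+1 * S ^+ t.+1)%g.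
have E1 : (P ^+ s * Q ^- r.+2 * (Q ^+ r.+2 * S ^+ t.+1) = P ^+ s * S ^+ t.+1)%g.
  by rewrite -mulgA mulKg.
have E2 : (P ^+ s * Q ^- r.+2 * (Q ^+ r.+1 * S ^+ t.+1) = P ^+ s.+1 * S ^+ t)%g.
  rewrite (expgSr Q r.+1) invgM !mulgA mulgVK.
  by rewrite expgS -QP !mulgA mulgVK -expgSr.
rewrite E1 phi_PS in T1; rewrite E2 phi_PS in T2.
have -> : c + a - b = phi (Q ^+ r.+2 * S ^+ t.+1)%g - phi (Q ^+ r.+1 * S ^+ t.+1)%g
    + (a *+ s.+1 + b *+ t) - (a *+ s + b *+ t.+1).
  by rewrite phi_QS !mulrS; ring.
rewrite mulr2n; apply: le_trans (lerD T1 T2); apply: le_trans (ler_normB _ _).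
by rewrite le_eqVlt; apply/orP; left; apply/eqP; congr `|_|; ring.
Qed.

(** Summed over a square grid, the [beta] terms of [two_triangles] telescope to a boundary
    contribution linear in the side of the grid, negligible against its area. *)
Lemma average_defect : `|c + a - b| <= D *+ 2.
Proof.
have D0 : 0 <= D by apply: le_trans (psi_defect 1%g 1%g).
have B0 : 0 <= B by apply: le_trans (beta_bounded 1%g).
set E := c + a - b.
have main N : `|E| *+ N <= D *+ 2 *+ N + B *+ 4.
  case: N => [|N]; first by rewrite add0r mulrn_wge0.
  (* In [two_triangles], the choice [t = N - s] turns the [beta] terms in [P] into [K s.+1 - K s],
     while those in [Q] telescope in [r] for each [s]. *)
  pose F (s r : nat) := beta (Q ^+ r.+1 * S ^+ (N.+1 - s))%g.
  pose K (s : nat) := beta (P ^+ s * S ^+ (N.+1 - s))%g.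
  have sumE : \sum_(0 <= s < N.+1) \sum_(0 <= r < N.+1)
      (E + (F s r.+1 - F s r) + (K s.+1 - K s)) =
      E *+ N.+1 *+ N.+1 + \sum_(0 <= s < N.+1) (F s N.+1 - F s 0%N)
      + (K N.+1 - K 0%N) *+ N.+1.
    transitivity (\sum_(0 <= s < N.+1)
        (E *+ N.+1 + (F s N.+1 - F s 0%N) + (K s.+1 - K s) *+ N.+1)).
      apply: eq_bigr => s _; rewrite 2!big_split /= !sumr_const_nat0.
      by rewrite (@telescope_sumr _ 0 N.+1 (F s)).
    by rewrite 2!big_split /= sumr_const_nat0 sumrMnl telescope_sumr.
  have sum_le : `|\sum_(0 <= s < N.+1) \sum_(0 <= r < N.+1)
      (E + (F s r.+1 - F s r) + (K s.+1 - K s))| <= D *+ 2 *+ N.+1 *+ N.+1.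
    rewrite -[leRHS]sumr_const_nat0 !big_mkord.
    apply: le_trans (ler_norm_sum _ _ _) _; apply: ler_sum => s _.
    rewrite -[leRHS]sumr_const_nat0 !big_mkord.
    apply: le_trans (ler_norm_sum _ _ _) _; apply: ler_sum => r _.
    by rewrite /F /K subSS subSn ?two_triangles// -ltnS.
  have dB g h : `|beta g - beta h| <= B *+ 2.
    by rewrite mulr2n (le_trans (ler_normB _ _))// lerD.
  have F_le : `|\sum_(0 <= s < N.+1) (F s N.+1 - F s 0%N)| <= B *+ 2 *+ N.+1.
    rewrite -[leRHS]sumr_const_nat0 !big_mkord.
    by apply: le_trans (ler_norm_sum _ _ _) _; apply: ler_sum => s _; apply: dB.
  have K_le : `|(K N.+1 - K 0%N) *+ N.+1| <= B *+ 2 *+ N.+1.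
    by rewrite normrMn lerMn2r dB orbT.
  rewrite -(@ler_pMn2r _ N.+1) // -normrMn -normrMn [leRHS]mulrnDl.
  have -> : E *+ N.+1 *+ N.+1 = (E *+ N.+1 *+ N.+1
      + \sum_(0 <= s < N.+1) (F s N.+1 - F s 0%N) + (K N.+1 - K 0%N) *+ N.+1)
      - \sum_(0 <= s < N.+1) (F s N.+1 - F s 0%N) - (K N.+1 - K 0%N) *+ N.+1.
    by ring.
  have B4 : B *+ 4 *+ N.+1 = B *+ 2 *+ N.+1 + B *+ 2 *+ N.+1.
    by rewrite -mulrnDl -mulrnDr.
  rewrite -sumE B4 [leRHS]addrA.
  apply: (le_trans (ler_normB _ _)); apply: lerD; last exact: K_le.
  by apply: (le_trans (ler_normB _ _)); apply: lerD; [exact: sum_le|exact: F_le].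
rewrite leNgt; apply/negP; rewrite -subr_gt0 => gap.
have := archi_boundP (divr_ge0 (mulrn_wge0 4 B0) (ltW gap)).
set N := Num.bound _; rewrite ltr_pdivrMr // mulr_natl mulrnBl ltrBrDl.
by rewrite ltNge main.
Qed.

End BoundedPerturbation.

Section Dilation.
Variables (R : realType) (f : int -> R) (M : nat).
Hypothesis M_gt0 : (0 < M)%N.

(* Dilation keeps the defect and kills the exponents smaller than [M]. *)
Definition dilation (k : int) : R := if (M %| k)%Z then f (k %/ M)%Z else 0.

Let dvdM (k : int) : (M %| k * M)%Z. Proof. by apply/dvdzP; exists k. Qed.

Lemma dilationM (k : int) : dilation (k * M) = f k.
Proof. by rewrite /dilation dvdM mulzK // -lt0n. Qed.

Lemma dilation_small k : f 0 = 0 -> (`|k| < M)%N -> dilation k = 0.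
Proof.
rewrite /dilation => f0 kM; case: ifP => // /dvdzP[q kE].
move: kM; rewrite kE abszM absz_nat; have [->|q0] := eqVneq q 0.
  by rewrite mul0r div0z.
by rewrite ltnNge leq_pmull // absz_gt0.
Qed.

Lemma dilation_odd : (forall k, f (- k) = - f k) ->
  forall k, dilation (- k) = - dilation k.
Proof.
move=> f_odd k; rewrite /dilation rpredN; case: ifP => [/dvdzP[q ->]|_].
  by rewrite -mulNr !mulzK ?f_odd// -lt0n.
by rewrite oppr0.
Qed.

(** If [a] and [b] are both multiples of [M], this is the defect of [f]; otherwise at most one of
    the three values is nonzero, and the bound on [f] itself applies. *)
Lemma dilation_defect D : (forall k, `|f k| <= D) ->
    (forall a b, `|f (a + b) - f a - f b| <= D) ->
  forall a b, `|dilation (a + b) - dilation a - dilation b| <= D.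
Proof.
move=> fD f_defect a b; have D0 : 0 <= D by apply: le_trans (fD 0).
have M0 : (M%:Z != 0) by rewrite -lt0n.
have [/dvdzP[p ->]|Ma] := boolP (M %| a)%Z.
  have [/dvdzP[q ->]|Mb] := boolP (M %| b)%Z; first by rewrite -mulrDl !dilationM.
  rewrite {1 3}/dilation rpredDl ?dvdM// (negbTE Mb).
  by rewrite subr0 sub0r normrN dilationM.
rewrite {2}/dilation (negbTE Ma) subr0.
have [/dvdzP[q ->]|Mb] := boolP (M %| b)%Z.
  rewrite {1}/dilation rpredDr ?dvdM// (negbTE Ma).
  by rewrite sub0r normrN dilationM.
rewrite [dilation b]/dilation (negbTE Mb) subr0 /dilation.
by case: ifP => //; rewrite normr0.
Qed.

End Dilation.

Section OddDefect.
Variables (R : realType) (f : int -> R) (B D : R).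
Hypothesis f_odd : forall k, f (- k) = - f k.
Hypothesis f_bounded : forall k, `|f k| <= B.

Lemma odd0 : f 0 = 0.
Proof. by have := f_odd 0; rewrite oppr0; lra. Qed.

(* [|f (2 k)| - D >= 2 (|f k| - D)], so a value above [D] would double for ever. *)
Lemma odd_bounded_le_defect : (forall a b, `|f (a + b) - f a - f b| <= D) ->
  forall k, `|f k| <= D.
Proof.
move=> f_defect k.
have grow t : (`|f k| - D) *+ 2 ^ t <= `|f (k * (2 ^ t)%N)| - D.
  elim: t => [|t IHt]; first by rewrite mulr1.
  have := f_defect (k * (2 ^ t)%N) (k * (2 ^ t)%N).
  have -> : k * (2 ^ t)%N + k * (2 ^ t)%N = k * (2 ^ t.+1)%N.
    by rewrite expnS mul2n -addnn PoszD mulrDr.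
  move=> uv; rewrite [in leLHS]expnSr mulrnA mulr2n.
  set u := f (k * (2 ^ t)%N) in IHt uv *; set v := f (k * (2 ^ t.+1)%N) in uv *.
  move: (_ *+ 2 ^ t) IHt => X IHt.
  have tri : `|u| + `|u| <= `|v| + `|v - u - u|.
    rewrite -mulr2n -normrMn (_ : u *+ 2 = v - (v - u - u)) ?ler_normB//.
    by rewrite mulr2n; ring.
  lra.
rewrite leNgt; apply/negP; rewrite -subr_gt0 => gap.
have B0 : 0 <= B by apply: le_trans (f_bounded 0).
have := archi_boundP (divr_ge0 B0 (ltW gap)).
set N := Num.bound _; rewrite ltr_pdivrMr // mulr_natl.
have D0 : 0 <= D by apply: le_trans (f_defect 0 0).
rewrite ltNge => /negP; apply.
apply: (@le_trans _ _ ((`|f k| - D) *+ 2 ^ N)).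
  rewrite -[leLHS]mulr_natr -[leRHS]mulr_natr ler_wpM2l ?(ltW gap)// ler_nat.
  exact/ltnW/ltn_expl.
apply: le_trans (grow N) _; have := f_bounded (k * (2 ^ N)%N); lra.
Qed.

End OddDefect.

(** * Finite index *)

Section Cochains.
Variables (R : realType) (G : groupType).
Implicit Types (phi : G -> R) (a b c g h : G).

Definition cochain1 phi : cochain R G 1 := fun u => phi (u ord0).

Definition pair2 a b : 'I_2 -> G := fun j => if j == ord0 then a else b.

Lemma pair2E (u : 'I_2 -> G) : pair2 (u ord0) (u ord_max) = u.
Proof.
apply/funext => j; rewrite /pair2; case: eqP => [->//|/eqP j0].
by congr u; apply/val_inj; case: j j0 => -[|[]].
Qed.

Lemma coboundary_cochain1 phi u :
  coboundary (cochain1 phi) u =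
    phi (u ord_max) - phi (u ord0 * u ord_max)%g + phi (u ord0).
Proof. by rewrite coboundary1E. Qed.

Lemma coboundary_pair2 phi a b :
  coboundary (cochain1 phi) (pair2 a b) = phi b - phi (a * b)%g + phi a.
Proof. exact: coboundary_cochain1. Qed.

Lemma cochain1E (f : cochain R G 1) : f = cochain1 (fun a => f (fun=> a)).
Proof. by apply/funext => u; congr f; apply/funext => j; rewrite ord1. Qed.

Lemma coboundary_coboundary1 phi : coboundary (coboundary (cochain1 phi)) = 0.
Proof.
apply/funext => u; rewrite coboundary2E !coboundary1E /cochain1 /= mulgA.
by rewrite [RHS]/GRing.zero /=; ring.
Qed.

Lemma cocycle_pair2 (xi : cochain R G 2) : coboundary xi = 0 -> forall a b c,
  xi (pair2 b c) - xi (pair2 (a * b)%g c) + xi (pair2 a (b * c)%g)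
    - xi (pair2 a b) = 0.
Proof.
move=> dxi a b c.
have := coboundary2E xi (fun j : 'I_3 => nth 1%g [:: a; b; c] j).
by rewrite dxi !inordK.
Qed.

Lemma supnorm_ge T (f : T -> R) : bounded f -> forall t, `|f t| <= supnorm f.
Proof.
move=> [B fB] t; apply: ub_le_sup; last by exists t.
by exists B => _ [u _ <-].
Qed.

Lemma supnorm_le T (f : T -> R) (t0 : T) B : (forall t, `|f t| <= B) -> supnorm f <= B.
Proof.
by move=> fB; apply: ge_sup => [|_ [t _ <-]//]; exists `|f t0|, t0.
Qed.

Lemma bounded_multiples_eq0 (c B : R) : (forall m, `|c| *+ m <= B) -> c = 0.
Proof.
move=> cB; apply/eqP; rewrite -normr_eq0 eq_le normr_ge0 andbT leNgt.
apply/negP => c0; have B0 : 0 <= B := cB 0%N.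
have := archi_boundP (divr_ge0 B0 (ltW c0)).
by rewrite ltr_pdivrMr // mulr_natl ltNge cB.
Qed.

End Cochains.

(* A cocycle [xi] defines the action [g (h, b) = (g h, b + xi (g, h))] of the
   free group, up to a correction [r g]; then [xi] is the coboundary of [- r]. *)
Section FreeGroupH2.
Variables (R : realType) (G : groupType) (I : Type) (x : I -> G).
Hypothesis x_free : free_basis x.
Variable xi : cochain R G 2.
Hypotheses (xi_cocycle : coboundary xi = 0) (xi11 : xi (pair2 1%g 1%g) = 0).

Let X a b : R := xi (pair2 a b).

Let X_cocycle a b c : X b c - X (a * b)%g c + X a (b * c)%g - X a b = 0.
Proof. exact: cocycle_pair2. Qed.

Let X1g h : X 1%g h = 0.
Proof. by have := X_cocycle 1%g 1%g h; rewrite !mul1g /X xi11; lra. Qed.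

Let Xg1 h : X h 1%g = 0.
Proof. by have := X_cocycle h 1%g 1%g; rewrite !mulg1 /X xi11; lra. Qed.

Let shift a (p : G * R) : G * R := ((a * p.1)%g, p.2 + X a p.1).
Let unshift a (p : G * R) : G * R := ((a^-1 * p.1)%g, p.2 - X a (a^-1 * p.1)%g).

Let shiftK a : cancel (shift a) (unshift a).
Proof. by case=> h b; rewrite /shift /unshift /= mulKg addrK. Qed.

Let unshiftK a : cancel (unshift a) (shift a).
Proof. by case=> h b; rewrite /shift /unshift /= mulVKg subrK. Qed.

Lemma free_cocycle_coboundary :
  exists phi : G -> R, coboundary (cochain1 phi) = xi.
Proof.
have [rho [[rhoM rhox] _]] := x_free (fun i => Bijection (@shiftK (x i)) (@unshiftK (x i))).
(* On generators the action is [shift]; on other elements it agrees with [shift] up to a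
   translation, by the cocycle identity. *)
have rhoE : forall g, exists r, forall h b,
    rho g (h, b) = ((g * h)%g, b + X g h + r).
  apply: (free_ind x_free) => [|i]; last first.
    by exists 0 => h b; rewrite rhox /= /shift /= addr0.
  split=> [|g g' [r rP] [r' r'P]|g [r rP]].
  - by exists 0 => h b; rewrite (morph_one rhoM) /= mul1g X1g !addr0.
  - exists (r + r' + X g g') => h b; rewrite rhoM bijM r'P rP mulgA.
    by congr pair; have := X_cocycle g g' h; lra.
  exists (- r - X g g^-1%g) => h b; rewrite (morph_inv rhoM).
  apply: (can_inj (@bfunK _ (rho g))); rewrite [LHS]binvK rP mulVKg.
  congr pair; have := X_cocycle g g^-1%g h; rewrite mulgV X1g; lra.
have [r rP] := choice rhoE; exists (fun g => - r g).
apply/funext => u; rewrite coboundary_cochain1.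
set g := u ord0; set g' := u ord_max.
(* Moving [(1, 0)] by [g * g'] in two ways gives [r (g * g') = r g + r g' + X g g']. *)
have := rP (g * g')%g 1%g 0; rewrite rhoM bijM !rP !mulg1 !Xg1 !add0r.
have -> : xi u = X g g' by rewrite /X /g /g' pair2E.
by case=> E; lra.
Qed.

End FreeGroupH2.

(** * Averaging over the cosets of a subgroup of finite index *)

Section Transfer.
Variables (R : realType) (G : groupType) (H : groupClosed G).
Hypothesis H_index : ~ infinite_index H.

Let rep (g : G) : G := xget 1%g [set h | coeq H g h].

Let repP g : coeq H g (rep g).
Proof. by rewrite /rep; case: xgetP => [h -> //|/(_ g)]; case; apply: coeq_refl. Qed.

Let rep_eq g h : coeq H g h -> rep g = rep h.
Proof.
move=> gh; rewrite /rep; congr xget; apply/seteqP; split=> c /= cP.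
  exact: coeq_trans (coeq_sym gh) cP.
exact: coeq_trans gh cP.
Qed.

Lemma coset_representatives : exists Y : seq G, [/\ uniq Y,
  forall g, rep g \in Y & forall y, y \in Y -> rep y = y].
Proof.
have /contrapT/finite_seqP[s sE] := H_index.
pose Y := undup [seq rep (xget 1%g [set g | left_coset H g = A]) | A <- s].
have repK g : rep (rep g) = rep g by apply/esym/rep_eq/repP.
exists Y; split; first exact: undup_uniq.
  move=> g; rewrite mem_undup.
  have gs : left_coset H g \in s.
    by have : [set` s]%classic (left_coset H g); [rewrite -sE; exists g|].
  apply/mapP; exists (left_coset H g) => //; apply: rep_eq.
  case: xgetP => [h _ /= hg|/(_ g)]; last by case.
  have : left_coset H h h by exists 1%g; rewrite ?mulg1 //=; apply: gpred1.
  by rewrite hg => -[c /= cH <-]; apply: coeq_sym; apply: coeqMr.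
by move=> y; rewrite mem_undup => /mapP[A _ ->].
Qed.

Variables (phi : G -> R) (K : R).
Hypothesis phi_defect : forall g h, `|phi h - phi (g * h)%g + phi g| <= K.
Hypothesis phi_hom : {in H &, forall g h, phi (g * h)%g = phi g + phi h}.

(** The elements averaged over lie in [H], where [phi] is additive, and left multiplication permutes
    the representatives, so the average is additive. They differ from [g] by factors from a finite
    set, whence the bound. *)
Lemma transfer_hom : exists psi : G -> R, {morph psi : g h / (g * h)%g >-> g + h} /\
  bounded (fun g => phi g - psi g).
Proof.
have [Y [Yuniq repY Yrep]] := coset_representatives.
have Y0 : (0 < size Y)%N by case: Y {Yuniq Yrep} repY => // /(_ 1%g).
pose T g y := phi ((rep (g * y)%g)^-1 * g * y)%g.
exists (fun g => (size Y)%:R^-1 * \sum_(y <- Y) T g y); split.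
  move=> g h /=; rewrite -mulrDr; congr (_ * _).
  have perm_h : perm_eq Y [seq rep (h * y)%g | y <- Y].
    have inj : {in Y &, injective (fun y => rep (h * y)%g)}.
      move=> y z yY zY yz; rewrite -(Yrep y yY) -(Yrep z zY).
      apply: rep_eq; apply/(@coeq_mul _ H h); apply: coeq_trans (repP _) _.
      by rewrite yz; apply: coeq_sym.
    rewrite perm_sym; apply: uniq_perm => //; first by rewrite map_inj_in_uniq.
    apply: (uniq_min_size _ _ _).2; rewrite ?map_inj_in_uniq ?size_map//.
    by move=> _ /mapP[y _ ->].
  rewrite [X in _ = X + _](perm_big _ perm_h) /= big_map -big_split /=.
  apply: eq_bigr => y _; rewrite /T.
  have -> : rep (g * h * y)%g = rep (g * rep (h * y))%g.
    by rewrite -mulgA; apply: rep_eq; apply/coeq_mul.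
  rewrite -phi_hom; first by congr phi; rewrite -!mulgA mulVKg.
    by rewrite -mulgA; apply: coeq_sym.
  by rewrite -mulgA; apply: coeq_sym.
pose L := \sum_(y <- Y) (`|phi y| + `|phi y^-1%g|).
have LY y : y \in Y -> `|phi y| + `|phi y^-1%g| <= L.
  move=> yY; rewrite /L (big_rem y)//= lerDl.
  by apply: sumr_ge0 => z _; rewrite addr_ge0.
(* Splitting off the two outer factors costs [K] each, and [phi] at each of them is at most [L]. *)
exists (K *+ 2 + L *+ 2) => g.
have -> : phi g - (size Y)%:R^-1 * \sum_(y <- Y) T g y =
    (size Y)%:R^-1 * \sum_(y <- Y) (phi g - T g y).
  rewrite sumrB big_const_seq count_predT iter_addr_0 mulrBr.
  by rewrite -[phi g *+ _]mulr_natl mulKf// pnatr_eq0 -lt0n.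
rewrite normrM ger0_norm ?invr_ge0// mulrC ler_pdivrMr ?ltr0n//.
apply: le_trans (ler_norm_sum _ _ _) _.
rewrite mulr_natr -(count_predT Y) -iter_addr_0 -big_const_seq.
rewrite !big_seq; apply: ler_sum => y yY.
have r1 := LY _ (repY (g * y)%g); have r2 := LY _ yY.
have d1 := phi_defect ((rep (g * y))^-1 * g)%g y.
have d2 := phi_defect (rep (g * y))^-1%g g.
rewrite /T; move: r1 r2 d1 d2.
set r := rep _; set A := phi (_ * y)%g; set B := phi (_ * g)%g => r1 r2 d1 d2.
have -> : phi g - A = (phi y - A + B) + (phi g - B + phi r^-1%g) - phi y - phi r^-1%g.
  by ring.
rewrite !mulr2n; apply: le_trans (ler_normB _ _) _.
rewrite [leRHS]addrA; apply: lerD; last by apply: le_trans r1; rewrite lerDr.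
apply: le_trans (ler_normB _ _) _; apply: lerD; last by apply: le_trans r2; rewrite lerDl.
exact: le_trans (ler_normD _ _) (lerD d1 d2).
Qed.

End Transfer.

Lemma Hb2_trivial_of_finite_index (R : realType) (G : groupType)
    (H : groupClosed G) (I : Type) (x : I -> G) :
  free_basis x -> ~ infinite_index H -> forall b : rel_Hb2 R H, b = 0.
Proof.
move=> x_free H_index b; rewrite -[b]of_quotK; set z := of_quot b.
apply/eqP; rewrite -[X in _ == X](raddf0 (to_quot (rel_B2_submod R H))).
apply/eqP/to_quot_eq; rewrite subr0; apply/rel_B2P.
have /andP[/rel_bcochainP[[K zK] z0] /eqP dz] := valP z.
have z11 : (val z : cochain R G 2) (pair2 1%g 1%g) = 0.
  by apply: z0 => i; rewrite /pair2; case: ifP => _; apply: gpred1.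
have [phi phiE] := free_cocycle_coboundary x_free dz z11.
have phi_defect g h : `|phi h - phi (g * h)%g + phi g| <= K.
  by rewrite -coboundary_pair2 phiE.
have phi_hom : {in H &, forall g h, phi (g * h)%g = phi g + phi h}.
  move=> g h gH hH; suff : phi h - phi (g * h)%g + phi g = 0 by lra.
  rewrite -coboundary_pair2 phiE; apply: z0 => i.
  by rewrite /pair2; case: ifP.
have [psi [psiM [B psiB]]] := transfer_hom H_index phi_defect phi_hom.
(* Subtracting a homomorphism keeps the coboundary; the difference is bounded, and a bounded
   homomorphism on [H] vanishes. *)
pose chi g := phi g - psi g.
have chi_hom : {in H &, forall g h, chi (g * h)%g = chi g + chi h}.
  by move=> g h gH hH; rewrite /chi phi_hom // psiM; ring.
have chi0 h : h \in H -> chi h = 0.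
  move=> hH; apply: (@bounded_multiples_eq0 _ _ B) => m.
  have <- : `|chi (h ^+ m)%g| = `|chi h| *+ m; last exact: psiB.
  rewrite -normrMn; congr `|_|; elim: m => [|m IHm].
    by have := chi_hom 1%g 1%g gpred1 gpred1; rewrite mulg1; lra.
  by rewrite expgS chi_hom ?gpredXn// IHm mulrS.
exists (cochain1 chi).
  by apply/rel_bcochainP; split=> [|g gH]; [exists B => g; apply: psiB|apply: chi0].
by rewrite -phiE; apply/funext => g; rewrite !coboundary_cochain1 /chi psiM; ring.
Qed.

(** * Infinite index *)

(** The coefficient matrix has [N.+1] rows and rank at most [N], so its left kernel is nonzero. *)
Lemma finite_dimensional_dependent (R : fieldType) (V : lmodType R) :
  finite_dimensional V -> exists N, forall w : 'I_N.+1 -> V,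
    exists2 u : 'I_N.+1 -> R, exists k, u k != 0 & \sum_k u k *: w k = 0.
Proof.
case=> N [v v_span]; exists N => w.
have [c cP] := choice (fun k => v_span (w k)).
pose A : 'M[R]_(N.+1, N) := \matrix_(k, i) c k i.
have kerA : kermx A != 0.
  by rewrite -mxrank_eq0 mxrank_ker -lt0n subn_gt0 ltnS rank_leq_col.
have /rowV0Pn[u /sub_kermxP uA u0] := kerA.
exists (fun k => u 0 k).
  apply/existsP; apply: contraNT u0 => /existsPn u0.
  by apply/eqP/rowP => k; rewrite mxE; apply/eqP; rewrite -[_ == _]negbK u0.
under eq_bigr do rewrite cP scaler_sumr.
rewrite exchange_big big1 //= => i _.
under eq_bigr do rewrite scalerA.
have ucE : \sum_k u 0 k * c k i = 0.
  have := congr1 (fun B : 'rV[R]_N => B 0 i) uA; rewrite !mxE => uAi; rewrite -[RHS]uAi.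
  by apply: eq_bigr => k _; rewrite mxE.
by rewrite -scaler_suml ucE scale0r.
Qed.

Section Bumps.
Variable R : realType.

(** The shift to [k.+1] avoids 0, where odd functions vanish; distinct bumps have disjoint
    supports. *)
Lemma alt_bump_subproof (k : nat) :
  (fun m : int => (m == k.+1)%:R - (m == - k.+1%:Z)%:R : R^o) \in @alt_bounded R.
Proof.
apply/alt_boundedP; split; last first.
  by move=> m; rewrite eqr_opp opprB -eqr_oppLR.
exists 2 => m; apply: le_trans (ler_normB _ _) _.
by case: (m == _); case: (m == _); rewrite /= ?normr1 ?normr0; lra.
Qed.

Definition alt_bump k : DZ R :=
  exist (fun f : int -> R^o => f \in @alt_bounded R) _ (alt_bump_subproof k).

Lemma alt_bumpE k l : val (alt_bump k) l.+1%:Z = (l == k)%:R.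
Proof.
rewrite -[LHS]/((l.+1%:Z == k.+1)%:R - (l.+1%:Z == - k.+1%:Z)%:R).
by rewrite eqz_nat eqSS (_ : (l.+1%:Z == - k.+1%:Z) = false) ?subr0//; lia.
Qed.

(** Injectivity pulls a dependency between images back to the bumps; evaluation at [k.+1] in
    coordinate [i0] isolates its coefficient [u k]. *)
Lemma DZ_infinite_dimensional n (V : lmodType R) (i0 : 'I_n)
    (phi : {linear {ffun 'I_n -> DZ R} -> V}) :
  injective phi -> ~ finite_dimensional V.
Proof.
move=> phi_inj /finite_dimensional_dependent[N /(_ (fun k => phi [ffun=> alt_bump k]))].
case=> u [k uk0] u_dep; move/negP: uk0; apply.
have /(congr1 (fun F : {ffun 'I_n -> DZ R} => val (F i0) k.+1%:Z)) :
    \sum_l u l *: [ffun=> alt_bump l] = 0 :> {ffun 'I_n -> DZ R}.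
  apply: phi_inj; rewrite linear0 -[RHS]u_dep linear_sum.
  by apply: eq_bigr => l _; rewrite linearZ.
have evalD (F G : {ffun 'I_n -> DZ R}) :
    val ((F + G) i0) k.+1%:Z = val (F i0) k.+1%:Z + val (G i0) k.+1%:Z.
  by rewrite ffunE.
have eval0 : val ((0 : {ffun 'I_n -> DZ R}) i0) k.+1%:Z = 0 by rewrite ffunE.
rewrite (big_morph (fun F : {ffun 'I_n -> DZ R} => val (F i0) k.+1%:Z) evalD eval0).
rewrite eval0 (bigD1 k) //= big1 => [|l lk].
  by rewrite addr0 !ffunE -[LHS]/(u k * val (alt_bump k) k.+1%:Z) alt_bumpE eqxx mulr1 => ->.
rewrite !ffunE -[LHS]/(u l * val (alt_bump l) k.+1%:Z) alt_bumpE.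
by rewrite val_eqE eq_sym (negbTE lk) mulr0.
Qed.

End Bumps.

Section Defect.
Variable R : realType.

Lemma DZ_odd (f : DZ R) k : val f (- k) = - val f k.
Proof. by have /alt_boundedP[_] := valP f; apply. Qed.

Lemma DZ_bounded (f : DZ R) : exists B, forall k, `|val f k| <= B.
Proof. by have /alt_boundedP[] := valP f. Qed.

Lemma defect_ge (f : DZ R) a b :
  `|val f (a + b) - val f a - val f b| <= defect (val f).
Proof.
have [B fB] := DZ_bounded f; apply: ub_le_sup; last by exists a, b.
exists (B + B + B) => _ [c [d ->]]; apply: le_trans (ler_normB _ _) _.
by rewrite lerD// (le_trans (ler_normB _ _))// lerD.
Qed.

Lemma defect_le (f : DZ R) D :
  (forall a b, `|val f (a + b) - val f a - val f b| <= D) -> defect (val f) <= D.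
Proof.
move=> fD; apply: ge_sup; last by move=> _ [a [b ->]].
by exists `|val f (0 + 0) - val f 0 - val f 0|, 0, 0.
Qed.

Lemma DZ_le_defect (f : DZ R) k : `|val f k| <= defect (val f).
Proof.
have [B fB] := DZ_bounded f.
exact: (odd_bounded_le_defect fB (defect_ge f)).
Qed.

Lemma maxnorm_ge n (F : {ffun 'I_n -> DZ R}) i : defect (val (F i)) <= maxnorm F.
Proof. exact: le_bigmax. Qed.

Lemma maxnorm_ge0 n (F : {ffun 'I_n -> DZ R}) : 0 <= maxnorm F.
Proof. exact: bigmax_ge_id. Qed.

Lemma maxnorm_le n (F : {ffun 'I_n -> DZ R}) D :
  0 <= D -> (forall i, defect (val (F i)) <= D) -> maxnorm F <= D.
Proof. by move=> D0 FD; apply/bigmax_leP; split=> // i _. Qed.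

Lemma maxnorm_eq0 n (F : {ffun 'I_n -> DZ R}) : maxnorm F = 0 -> F = 0.
Proof.
move=> F0; apply/ffunP => i; rewrite ffunE; apply/val_inj/funext => k /=.
by apply/eqP; rewrite -normr_le0 -F0 (le_trans (DZ_le_defect _ _))// maxnorm_ge.
Qed.

End Defect.

(** The pants with exponents [a], [b], [- (a + b)] turn [average_defect] into twice the claim; if
    one of these is zero, oddness makes the left side zero. *)
Lemma split_qm_lower (R : realType) (n : nat) (f : 'I_n -> int -> R)
    (G : groupType) (x : 'I_n -> G) (beta : G -> R) (B D : R) (i j : 'I_n) :
    (forall i k, f i (- k) = - f i k) -> free_basis x ->
    (forall g, `|beta g| <= B) ->
    (forall g h, `|(split_qm f x h + beta h)
      - (split_qm f x (g * h)%g + beta (g * h)%g) + (split_qm f x g + beta g)| <= D) ->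
    i != j ->
  forall a b, `|f i (a + b) - f i a - f i b| <= D.
Proof.
move=> f_odd x_free beta_bounded psi_defect ij a b.
have D0 : 0 <= D by apply: le_trans (psi_defect 1%g 1%g).
have f0 := odd0 (f_odd i).
have [->|a0] := eqVneq a 0; first by rewrite add0r f0 subr0 subrr normr0.
have [->|b0] := eqVneq b 0; first by rewrite addr0 f0 subr0 subrr normr0.
have [ab|ab0] := eqVneq (a + b) 0.
  have -> : b = - a by lia.
  by rewrite subrr f0 f_odd opprK sub0r addNr normr0.
have k123 : a + b + - (a + b) = 0 by rewrite subrr.
have ab0' : - (a + b) != 0 by rewrite oppr_eq0.
have := average_defect beta_bounded psi_defect
  (pants_relation x ij k123 a0 b0 ab0') (split_qm_PS f_odd x_free ij a0 ab0')
  (split_qm_QS f_odd x_free ij k123 a0 b0 ab0').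
rewrite !f_odd -!mulNrn -!mulrnDl normrMn ler_pMn2r //.
by congr (`|_| <= _); ring.
Qed.

(** * The isometric embedding built from dilated functions *)

Section Embedding.
Variables (R : realType) (G : groupType) (H : groupClosed G) (n : nat).
Variables (x : 'I_n -> G) (M : nat).
Hypotheses (x_free : free_basis x) (M_gt0 : (0 < M)%N).
Hypothesis H_exponents : forall h, h \in H -> forall s, s \in nf x h -> (`|s.2| < M)%N.

Let dil (F : {ffun 'I_n -> DZ R}) i : int -> R := dilation (val (F i)) M.

Let dil_odd F i k : dil F i (- k) = - dil F i k.
Proof. by apply: dilation_odd => // l; apply: DZ_odd. Qed.

Let dil_defect F i a b :
  `|dil F i (a + b) - dil F i a - dil F i b| <= maxnorm F.
Proof.
apply: le_trans (maxnorm_ge F i).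
by apply: dilation_defect => // [k|c d]; [apply: DZ_le_defect|apply: defect_ge].
Qed.

Definition relative_qm F : G -> R := split_qm (dil F) x.

Lemma relative_qm_defect F g h :
  `|relative_qm F h - relative_qm F (g * h)%g + relative_qm F g| <= maxnorm F.
Proof.
by apply: (split_qm_defect (dil_odd F) x_free (maxnorm_ge0 F)); apply: dil_defect.
Qed.

Lemma relative_qm_vanishes F h : h \in H -> relative_qm F h = 0.
Proof.
move=> hH; rewrite /relative_qm /split_qm /word_sum big_seq big1 // => s sh.
apply: dilation_small; first by apply: odd0 => k; apply: DZ_odd.
exact: H_exponents hH s sh.
Qed.

Lemma relative_qm_linear a F F' g :
  relative_qm (a *: F + F') g = a * relative_qm F g + relative_qm F' g.
Proof.
rewrite /relative_qm /split_qm /word_sum mulr_sumr -big_split /=.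
apply: eq_bigr => s _; rewrite /dil /dilation !ffunE /=.
by case: ifP => // _; rewrite mulr0 addr0.
Qed.

Lemma qm_cocycle_subproof F :
  coboundary (cochain1 (relative_qm F)) \in @rel_bcocycle R G H.
Proof.
apply/andP; split; last exact/eqP/coboundary_coboundary1.
apply/rel_bcochainP; split=> [|g gH].
  by exists (maxnorm F) => g; rewrite coboundary_cochain1 relative_qm_defect.
by rewrite coboundary_cochain1 !relative_qm_vanishes ?gpredM// subr0 addr0.
Qed.

Definition qm_cocycle F : rel_Z2 R H :=
  exist (fun f : cochain R G 2 => f \in @rel_bcocycle R G H) _ (qm_cocycle_subproof F).

Definition qm_class (F : {ffun 'I_n -> DZ R}) : rel_Hb2 R H :=
  rel_class (qm_cocycle F).

Lemma qm_class_is_linear : linear qm_class.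
Proof.
move=> a F F'; rewrite /qm_class /rel_class -linearP; congr to_quot.
apply/val_inj/funext => g.
rewrite -[LHS]/(coboundary (cochain1 (relative_qm (a *: F + F'))) g).
rewrite -[RHS]/(a * coboundary (cochain1 (relative_qm F)) g
  + coboundary (cochain1 (relative_qm F')) g).
by rewrite !coboundary_cochain1 !relative_qm_linear; ring.
Qed.

HB.instance Definition _ :=
  GRing.isLinear.Build R {ffun 'I_n -> DZ R} (rel_Hb2 R H) _ qm_class
    qm_class_is_linear.

Lemma supnorm_qm_cocycle F :
  supnorm (val (qm_cocycle F) : cochain R G 2) <= maxnorm F.
Proof.
apply: (supnorm_le (fun=> 1%g)) => g /=.
by rewrite coboundary_cochain1 relative_qm_defect.
Qed.

(** A representative is the coboundary of [relative_qm F] plus a bounded function, so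
    [split_qm_lower] applies; [1 < n] supplies the second basis element. *)
Lemma maxnorm_le_supnorm F (z : rel_Z2 R H) : (1 < n)%N ->
  rel_class z = qm_class F -> maxnorm F <= supnorm (val z : cochain R G 2).
Proof.
move=> n1 /to_quot_eq /rel_B2P[f /rel_bcochainP[[B fB] _] df].
have z_bounded : bounded (val z : cochain R G 2).
  by have /andP[/rel_bcochainP[]] := valP z.
have sz g := supnorm_ge z_bounded g.
have sz0 : 0 <= supnorm (val z : cochain R G 2) by apply: le_trans (sz (fun=> 1%g)).
pose beta a := f (fun=> a).
have zE : val z = coboundary (cochain1 (relative_qm F)) + coboundary (cochain1 beta).
  rewrite -cochain1E df; apply/funext => g.
  by rewrite -[RHS]/(val (qm_cocycle F) g + (val z g - val (qm_cocycle F) g)) addrC subrK.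
apply: maxnorm_le => // i; apply: defect_le => a b.
have [j ij] : exists j : 'I_n, i != j.
  case: (eqVneq i (Ordinal (ltnW n1))) => [->|]; last by exists (Ordinal (ltnW n1)).
  by exists (Ordinal n1).
(* The dilation takes the values of [F i] at multiples of [M], so a bound on its defect suffices. *)
rewrite -(dilationM (val (F i)) M_gt0) -!(dilationM (val (F i)) M_gt0) mulrDl.
apply: (split_qm_lower (dil_odd F) x_free (beta := beta) (B := B) _ _ ij) => g; first exact: fB.
move=> h; apply: le_trans (sz (pair2 g h)); rewrite zE.
rewrite -[(_ + _) (pair2 g h)]/(coboundary (cochain1 (relative_qm F)) (pair2 g h)
  + coboundary (cochain1 beta) (pair2 g h)) !coboundary_pair2 -/(relative_qm F).
by rewrite le_eqVlt; apply/orP; left; apply/eqP; congr `|_|; ring.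
Qed.

Lemma qm_class_isometric : (1 < n)%N -> forall F, Hb2_seminorm (qm_class F) = maxnorm F.
Proof.
move=> n1 F; apply/eqP; rewrite eq_le; apply/andP; split.
  apply: le_trans (supnorm_qm_cocycle F); apply: ge_inf; last by exists (qm_cocycle F).
  by exists (maxnorm F) => _ [z /= zF <-]; apply: maxnorm_le_supnorm.
apply: lb_le_inf; first by exists (supnorm (val (qm_cocycle F) : cochain R G 2)), (qm_cocycle F).
by move=> _ [z /= zF <-]; apply: maxnorm_le_supnorm.
Qed.

(** The zero cocycle represents the trivial class, so an element of the kernel has [maxnorm] at most
    0. *)
Lemma qm_class_injective : (1 < n)%N -> injective qm_class.
Proof.
move=> n1; apply: raddf_inj => F F0; apply: maxnorm_eq0; apply/eqP.
rewrite eq_le maxnorm_ge0 andbT.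
have zE : rel_class (0 : rel_Z2 R H) = qm_class F by rewrite F0 /rel_class linear0.
apply: le_trans (maxnorm_le_supnorm n1 zE) _.
by apply: (supnorm_le (fun=> 1%g)) => g; rewrite normr0.
Qed.

End Embedding.

(** * Assembly of the equivalences *)

Lemma infinite_index_inequivalent (G : groupType) (H : groupClosed G) :
  infinite_index H -> forall X : seq G, exists g, forall c, c \in X -> ~ coeq H g c.
Proof.
move=> H_inf X; apply: contrapT => noX; apply: H_inf.
apply: (@sub_finite_set _ _ [set` map (left_coset H) X]%classic); last exact: finite_seq.
move=> _ [g _ <-] /=; apply: contrapT => gX; apply: noX; exists g => c cX gc.
apply: gX; apply/mapP; exists c => //; apply/seteqP; split=> _ [h /= hH <-].
  exists (c^-1 * g * h)%g; last by rewrite -!mulgA mulVKg.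
  by apply: gpredM => //; apply: coeq_sym.
exists (g^-1 * c * h)%g; last by rewrite -!mulgA mulVKg.
exact: gpredM.
Qed.

Lemma isometric_embedding (R : realType) (n : nat) (G : groupType)
    (H : groupClosed G) : (2 <= n)%N -> free_of_rank G n -> finite_rank H ->
  infinite_index H ->
  exists phi : {linear {ffun 'I_n -> DZ R} -> rel_Hb2 R H},
    injective phi /\ forall F, Hb2_seminorm (phi F) = maxnorm F.
Proof.
move=> n1 [x0 x0_free] H_fin /infinite_index_inequivalent H_inf.
have [x [x_free aper]] := aperiodic_basis H_fin H_inf x0_free.
have [M HM] := exponent_bound H_fin x_free aper.
(* The successor guarantees a positive dilation factor. *)
have HM1 h : h \in H -> forall s, s \in nf x h -> (`|s.2| < M.+1)%N.
  by move=> hH s /(HM h hH)/ltnW; rewrite ltnS.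
exists (@qm_class R G H n x M.+1 x_free isT HM1); split.
  exact: qm_class_injective.
exact: qm_class_isometric.
Qed.

Theorem theorem1p1 (R : realType) (n : nat) (Gam : groupType)
    (H : groupClosed Gam) (n_ge2 : (2 <= n)%N)
    (Gam_free : free_of_rank Gam n) (H_fin : finite_rank H) :
  [<-> infinite_index H;
       exists b : rel_Hb2 R H, b <> 0;
       ~ finite_dimensional (rel_Hb2 R H);
       exists phi : {linear {ffun 'I_n -> DZ R} -> rel_Hb2 R H},
         injective phi /\ forall F, Hb2_seminorm (phi F) = maxnorm F].
Proof.
have h14 := @isometric_embedding R n Gam H n_ge2 Gam_free H_fin.
have h43 : (exists phi : {linear {ffun 'I_n -> DZ R} -> rel_Hb2 R H},
    injective phi /\ forall F, Hb2_seminorm (phi F) = maxnorm F) ->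
    ~ finite_dimensional (rel_Hb2 R H).
  by case=> phi [phi_inj _]; apply: DZ_infinite_dimensional (Ordinal n_ge2) _ phi_inj.
have h32 : ~ finite_dimensional (rel_Hb2 R H) -> exists b : rel_Hb2 R H, b <> 0.
  move=> infdim; apply: contrapT => no_b; apply: infdim.
  exists 0%N, (fun=> 0) => b; exists (fun=> 0); rewrite big_ord0.
  by apply: contrapT => b0; apply: no_b; exists b.
have h21 : (exists b : rel_Hb2 R H, b <> 0) -> infinite_index H.
  case=> b b0; apply: contrapT => H_index; apply: b0.
  by have [x x_free] := Gam_free; apply: Hb2_trivial_of_finite_index x_free H_index b.
(* The implications at hand run through the cycle 1, 4, 3, 2, 1, opposite to the one required, so
   each goal is a composite of three. *)
tfae.
- by move=> /h14/h43/h32.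
- by move=> /h21/h14/h43.
- by move=> /h32/h21/h14.
- by move=> /h43/h32/h21.
Qed.
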